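(* Suppose that incremental or decremental $s$-$t$ Shortest Paths can be maintained with $P(m)$ preprocessing time and $u(m)$ amortized update and query time, where $m$ is the number of edges. Then OMv3 on $n\times n$ matrices can be solved with $P(O(n^2))$ preprocessing time and $n^2\cdot u(O(n^2))$ total query time.
   Context: OMv3 problem: given an $n\times n$ Boolean matrix $A$ that may be preprocessed, answer $n$ queries online, where each query consists of three length-$n$ Boolean vectors $u,v,w$, and the answer must be the Boolean value $\bigvee_{i,j,k}(u_i\wedge v_j\wedge w_k\wedge A[i,j]\wedge A[j,k]\wedge A[k,i])$, output before the next query is given. In incremental (resp. decremental) $s$-$t$ Shortest Paths, an unweighted graph undergoes only edge insertions (resp. deletions), two vertices $s,t$ are fixed, and queries ask for the current shortest-path distance from $s$ to $t$. *)

(* Defs.v *)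
From HB Require Import structures.
From mathcomp Require Import all_boot all_algebra.
Set Implicit Arguments.
Unset Strict Implicit.
Unset Printing Implicit Defensive.

(** * Word RAM

    Running times are measured on a deterministic word RAM with word length
    [w].  A program is a fixed finite text, independent of the instance and of
    [w], over finitely many registers and finitely many word-indexed arrays
    (finitely many arrays simulate, and are simulated by, a single memory with
    constant overhead).  Every operation on words costs one unit. *)

Inductive binop :=
  | Add | Sub | Mul | Div | Mod | And | Or | Xor | Shl | Shr | Eq | Lt.

(* Registers and arrays are named by natural numbers.  A word is true in [If]
   and [While] when it is nonzero. *)
Inductive cmd :=
  | Skip
  | Const of nat & nat              (* x := k *)
  | Op of nat & binop & nat & nat   (* x := y op z *)
  | Read of nat & nat & nat         (* x := a[y] *)
  | Write of nat & nat & nat        (* a[x] := y *)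
  | Seq of cmd & cmd
  | If of nat & cmd & cmd
  | While of nat & cmd.

Record state := State { reg : nat -> nat; arr : nat -> nat -> nat }.

Definition state0 : state := State (fun=> 0) (fun _ _ => 0).

Definition wrap (w x : nat) : nat := x %% 2 ^ w.

Definition eval_binop (w : nat) (o : binop) (x y : nat) : nat :=
  wrap w match o with
         | Add => x + y
         | Sub => x + (2 ^ w - y)
         | Mul => x * y
         | Div => x %/ y
         | Mod => x %% y
         | And => Nat.land x y
         | Or => Nat.lor x y
         | Xor => Nat.lxor x y
         | Shl => x * 2 ^ y
         | Shr => x %/ 2 ^ y
         | Eq => x == y
         | Lt => x < y
         end.

Definition set_reg (x v : nat) (st : state) : state :=
  State (fun y => if y == x then v else reg st y) (arr st).

Definition set_arr (a i v : nat) (st : state) : state :=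
  State (reg st)
    (fun b j => if (b == a) && (j == i) then v else arr st b j).

(* [runs w c st t st']: started in [st], [c] halts in [st'] after [t] steps. *)
Inductive runs (w : nat) : cmd -> state -> nat -> state -> Prop :=
  | runs_skip st : runs w Skip st 1 st
  | runs_const x k st : runs w (Const x k) st 1 (set_reg x (wrap w k) st)
  | runs_op x o y z st :
      runs w (Op x o y z) st 1
        (set_reg x (eval_binop w o (reg st y) (reg st z)) st)
  | runs_read x a y st :
      runs w (Read x a y) st 1 (set_reg x (arr st a (reg st y)) st)
  | runs_write a x y st :
      runs w (Write a x y) st 1 (set_arr a (reg st x) (reg st y) st)
  | runs_seq c1 c2 st t1 st1 t2 st2 :
      runs w c1 st t1 st1 -> runs w c2 st1 t2 st2 ->
      runs w (Seq c1 c2) st (t1 + t2) st2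
  | runs_if x c1 c2 st t st' :
      runs w (if reg st x != 0 then c1 else c2) st t st' ->
      runs w (If x c1 c2) st t.+1 st'
  | runs_while_end x c st : reg st x = 0 -> runs w (While x c) st 1 st
  | runs_while_step x c st t1 st1 t2 st2 :
      reg st x != 0 -> runs w c st t1 st1 -> runs w (While x c) st1 t2 st2 ->
      runs w (While x c) st (t1 + t2).+1 st2.

(** * Interactive algorithms

    An input is a list of words.  It is handed over in array 0, its length in
    register 0; the rest of the memory is left as the previous call left it.
    The output is read off register 1. *)

Definition with_input (w : nat) (inp : seq nat) (st : state) : state :=
  State (fun y => if y == 0 then wrap w (size inp) else reg st y)
    (fun b j => if (b == 0) && (j < size inp) then wrap w (nth 0 inp j)
                else arr st b j).

Definition output (st : state) : nat := reg st 1.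

(* Receiving the input is charged one step per word, plus one step for the
   call, so that no procedure runs in less time than its input length. *)
Definition call (w : nat) (c : cmd) (inp : seq nat) (st : state) (t : nat)
    (st' : state) : Prop :=
  exists2 t', t = (size inp).+1 + t' & runs w c (with_input w inp st) t' st'.

(* [serves w proc enc next ok a qs st T]: from memory [st], the requests [qs]
   are answered one after the other in total time [T].  [a] is the abstract
   state of the problem instance, [next] its evolution, and [ok a q r] says
   that [r] is an acceptable output for request [q]. *)
Inductive serves (A Q : Type) (w : nat) (proc : Q -> cmd) (enc : Q -> seq nat)
    (next : A -> Q -> A) (ok : A -> Q -> nat -> Prop) :
    A -> seq Q -> state -> nat -> Prop :=
  | serves_nil a st : serves w proc enc next ok a [::] st 0
  | serves_cons a q qs st t st' T :
      call w (proc q) (enc q) st t st' -> ok a q (output st') ->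
      serves w proc enc next ok (next a q) qs st' T ->
      serves w proc enc next ok a (q :: qs) st (t + T).

(** * Partially dynamic s-t Shortest Paths *)

Inductive mode := Incremental | Decremental.

(* A graph on the vertices 0, ..., N-1 is a duplicate-free list of pairs.  An
   edge of an undirected graph is listed once, smaller endpoint first. *)
Definition is_edge (directed : bool) (N : nat) (e : nat * nat) : bool :=
  [&& e.1 < N, e.2 < N & if directed then e.1 != e.2 else e.1 < e.2].

Definition is_graph (directed : bool) (N : nat) (E : seq (nat * nat)) : bool :=
  all (is_edge directed N) E && uniq E.

Definition adj (directed : bool) (E : seq (nat * nat)) : rel nat :=
  fun a b => ((a, b) \in E) || (~~ directed && ((b, a) \in E)).

Definition walk (directed : bool) (E : seq (nat * nat)) (s t l : nat) : Prop :=
  exists p : seq nat,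
    [/\ path (adj directed E) s p, last s p = t & size p = l].

Definition is_dist (directed : bool) (E : seq (nat * nat)) (s t d : nat) :
    Prop :=
  walk directed E s t d /\ forall l, walk directed E s t l -> d <= l.

(* Finite distances are less than [N]; the output [N] stands for infinity. *)
Definition dist_answer (directed : bool) (N s t : nat) (E : seq (nat * nat))
    (r : nat) : Prop :=
  is_dist directed E s t r \/
  (r = N /\ forall l, ~ walk directed E s t l).

Inductive request := Update of nat * nat | Query.

Definition next_graph (md : mode) (E : seq (nat * nat)) (q : request) :
    seq (nat * nat) :=
  match q, md with
  | Update e, Incremental => e :: E
  | Update e, Decremental => rem e E
  | Query, _ => E
  end.

Definition request_ok (directed : bool) (N s t : nat) (E : seq (nat * nat))
    (q : request) (r : nat) : Prop :=
  if q is Query then dist_answer directed N s t E r else True.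

Fixpoint legal (directed : bool) (md : mode) (N m : nat) (E : seq (nat * nat))
    (qs : seq request) : bool :=
  if qs is q :: qs' then
    match q, md with
    | Update e, Incremental =>
        [&& is_edge directed N e, e \notin E & size E < m]
    | Update e, Decremental => e \in E
    | Query, _ => true
    end && legal directed md N m (next_graph md E q) qs'
  else true.

(* [m] is the number of edges of the largest graph of the sequence: the number
   of initial edges in the decremental case, an upper bound on the number of
   final edges in the incremental case.  Since the time bounds depend on [m]
   only, the number of vertices is at most that of a connected graph with [m]
   edges. *)
Definition is_instance (directed : bool) (md : mode) (N m s t : nat)
    (E : seq (nat * nat)) (qs : seq request) : bool :=
  [&& is_graph directed N E, s < N, t < N, N <= m.+1,
      (if md is Incremental then size E <= m else size E == m)
    & legal directed md N m E qs].

Definition edge_words (e : nat * nat) : seq nat := [:: e.1; e.2].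

Definition graph_words (N m s t : nat) (E : seq (nat * nat)) : seq nat :=
  [:: N; m; s; t] ++ flatten [seq edge_words e | e <- E].

Definition request_words (q : request) : seq nat :=
  if q is Update e then edge_words e else [::].

Record sp_algorithm :=
  SPAlgorithm { sp_prep : cmd; sp_update : cmd; sp_query : cmd }.

Definition sp_proc (D : sp_algorithm) (q : request) : cmd :=
  if q is Update _ then sp_update D else sp_query D.

(* Preprocessing time O(P(m)) and amortized time O(u(m)) per update and query,
   on every word length w >= kappa * log2 (m + 2).  As usual for partially
   dynamic problems, the cost of the at most [m] updates that the whole
   sequence can contain may be incurred early: k requests take O((m + k) u(m))
   time.  This is implied by a bound of O(k u(m)). *)
Definition maintains_stSP (directed : bool) (md : mode) (P u : nat -> nat) :
    Prop :=
  exists (D : sp_algorithm) (kappa c : nat),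
  forall (w N m s t : nat) (E : seq (nat * nat)) (qs : seq request),
    (m + 2) ^ kappa <= 2 ^ w ->
    is_instance directed md N m s t E qs ->
    exists (tp T : nat) (st : state),
      [/\ call w (sp_prep D) (graph_words N m s t E) state0 tp st,
          tp <= c * P m,
          serves w (sp_proc D) request_words (next_graph md)
            (request_ok directed N s t) E qs st T
        & T <= c * ((m + size qs) * u m)].

(** * OMv3 *)

Definition omv3_query (n : nat) : Type :=
  ('rV[bool]_n * 'rV[bool]_n * 'rV[bool]_n)%type.

Definition omv3_answer (n : nat) (A : 'M[bool]_n) (q : omv3_query n) : bool :=
  let: (u, v, x) := q in
  [exists i : 'I_n, exists j : 'I_n, exists k : 'I_n,
    [&& u ord0 i, v ord0 j, x ord0 k, A i j, A j k & A k i]].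

Definition vector_words (n : nat) (v : 'rV[bool]_n) : seq nat :=
  [seq nat_of_bool (v ord0 i) | i <- enum 'I_n].

(* The side length, then the entries row by row. *)
Definition matrix_words (n : nat) (A : 'M[bool]_n) : seq nat :=
  n :: [seq nat_of_bool (A i j) | i <- enum 'I_n, j <- enum 'I_n].

Definition omv3_words (n : nat) (q : omv3_query n) : seq nat :=
  let: (u, v, x) := q in vector_words u ++ vector_words v ++ vector_words x.

(* [prep] time O(pre n), and O(tot n) total time for the n online queries, on
   every word length w >= kappa * log2 (n + 2). *)
Definition solves_OMv3 (pre tot : nat -> nat) : Prop :=
  exists (prep query : cmd) (kappa c : nat),
  forall (w n : nat) (A : 'M[bool]_n) (qs : seq (omv3_query n)),
    0 < n ->
    (n + 2) ^ kappa <= 2 ^ w ->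
    size qs = n ->
    exists (tp T : nat) (st : state),
      [/\ call w prep (matrix_words A) state0 tp st,
          tp <= c * pre n,
          serves w (fun=> query) (@omv3_words n) (fun A' _ => A')
            (fun A' q r => r = omv3_answer A' q) A qs st T
        & T <= c * tot n].

(* Main.v *)
From mathcomp Require Import all_boot matrix zify.
Require Import Defs.
Set Implicit Arguments.
Unset Strict Implicit.
Unset Printing Implicit Defensive.

(** An OMv3 query asks for a closed walk i, j, k, i with u_i, v_j, w_k.  In a
    layered graph, s reaches row i, then a vertex j with A[i,j], then a vertex
    k with A[j,k], then a copy of row i with A[k,i], and then t.  The rows are
    attached to long paths at s and at t, and each vertex j and k is left
    through a path of its own; a shortest s-t path uses the attachments nearest
    to the beginning of these paths, so the current distance sees only the
    attachments of the current query and row, although links are only ever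
    inserted (moving towards the beginning) or only ever deleted (moving
    away).  A failed test costs at least one extra step, which a 1-Lipschitz
    potential certifies.  Every query thus takes O(n) updates and at most n
    distance queries on a single graph with O(n^2) edges, all of them
    independent of the answers, and the hypothesis is applied once to the whole
    request sequence.  Since the input length is charged, P(m) = Omega(n^2) and
    u(m) >= 1 absorb the overhead. *)

(** * Running a program inside another one *)

(* Registers below [reg_shift] and array 0 are our own; the others hold the
   memory of the simulated algorithm. *)
Definition reg_shift := 40.

Fixpoint shift_cmd (c : cmd) : cmd :=
  let r x := x + reg_shift in
  match c with
  | Skip => Skip
  | Const x k => Const (r x) k
  | Op x o y z => Op (r x) o (r y) (r z)
  | Read x a y => Read (r x) a.+1 (r y)
  | Write a x y => Write a.+1 (r x) (r y)
  | Seq c1 c2 => Seq (shift_cmd c1) (shift_cmd c2)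
  | If x c1 c2 => If (r x) (shift_cmd c1) (shift_cmd c2)
  | While x c => While (r x) (shift_cmd c)
  end.

Definition embeds (sg st : state) : Prop :=
  (forall x, reg st (x + reg_shift) = reg sg x) /\
  forall a i, arr st a.+1 i = arr sg a i.

Definition same_below (d : nat) (st st' : state) : Prop :=
  (forall y, y < d -> reg st' y = reg st y) /\
  forall i, arr st' 0 i = arr st 0 i.

Lemma same_below_trans d st1 st2 st3 :
  same_below d st1 st2 -> same_below d st2 st3 -> same_below d st1 st3.
Proof. by move=> [r1 a1] [r2 a2]; split=> *; rewrite ?a2 // r2 ?r1. Qed.

Lemma same_below_leq d d' st st' :
  d <= d' -> same_below d' st st' -> same_below d st st'.
Proof. by move=> dd' [r a]; split=> // y yd; apply/r/(leq_trans yd). Qed.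

Lemma embeds_set_reg x v sg st : embeds sg st ->
  embeds (set_reg x v sg) (set_reg (x + reg_shift) v st) /\
  same_below reg_shift st (set_reg (x + reg_shift) v st).
Proof.
move=> [er ea]; split; split=> //= y; first by rewrite eqn_add2r er.
by case: eqP => // ->; rewrite ltnNge leq_addl.
Qed.

Lemma embeds_set_arr a i v sg st : embeds sg st ->
  embeds (set_arr a i v sg) (set_arr a.+1 i v st).
Proof. by move=> [er ea]; split=> //= b j; rewrite eqSS ea. Qed.

Lemma shift_runs w c sg t sg' st :
  runs w c sg t sg' -> embeds sg st ->
  exists st', [/\ runs w (shift_cmd c) st t st', embeds sg' st'
    & same_below reg_shift st st'].
Proof.
move=> r; elim: r st => {c sg t sg'}.
- by move=> sg st em; exists st; split=> //; apply: runs_skip.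
- move=> x k sg st em; have [em' own_memory] := embeds_set_reg x (wrap w k) em.
  by eexists; split; [apply: runs_const|exact: em'|].
- move=> x o y z sg st em; have [er _] := em; rewrite -!er.
  have [em' own_memory] :=
    embeds_set_reg x (eval_binop w o (reg sg y) (reg sg z)) em.
  by eexists; split; [apply: runs_op|rewrite !er|rewrite !er].
- move=> x a y sg st em; have [er ea] := em; rewrite -er -ea.
  have [em' own_memory] := embeds_set_reg x (arr sg a (reg sg y)) em.
  by eexists; split; [apply: runs_read|rewrite er ea|rewrite er ea].
- move=> a x y sg st em; have [er _] := em; rewrite -!er.
  have em' := embeds_set_arr a (reg sg x) (reg sg y) em.
  by eexists; split; [apply: runs_write|rewrite !er|].
- move=> c1 c2 sg t1 sg1 t2 sg2 _ IH1 _ IH2 st em.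
  have [st1 [r1 em1 own1]] := IH1 _ em; have [st2 [r2 em2 own2]] := IH2 _ em1.
  exists st2; split=> //; first exact: runs_seq r1 r2.
  exact: same_below_trans own1 own2.
- move=> x c1 c2 sg t sg' _ IH st em; have [st1 [r1 em1 own1]] := IH _ em.
  exists st1; split=> //=; apply: runs_if.
  by case: em => -> _; case: ifP r1.
- move=> x c sg x0 st em; exists st; split=> //.
  by apply: runs_while_end; case: em => ->.
- move=> x c sg t1 sg1 t2 sg2 x0 _ IH1 _ IH2 st em.
  have [st1 [r1 em1 own1]] := IH1 _ em; have [st2 [r2 em2 own2]] := IH2 _ em1.
  exists st2; split=> //; last exact: same_below_trans own1 own2.
  by apply: runs_while_step r1 r2; case: em => ->.
Qed.

(** * Expressions *)

(* A program keeps the dimension [n] in register 2 and its local variable [i]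
   in register [i + 3]. *)
Inductive expr :=
  | ENat of nat
  | EDim
  | EVar of nat
  | EAdd of expr & expr
  | EMul of expr & expr.

Fixpoint eval (n : nat) (env : seq nat) (e : expr) : nat :=
  match e with
  | ENat k => k
  | EDim => n
  | EVar i => nth 0 env i
  | EAdd e1 e2 => eval n env e1 + eval n env e2
  | EMul e1 e2 => eval n env e1 * eval n env e2
  end.

Fixpoint scoped (k : nat) (e : expr) : bool :=
  match e with
  | ENat _ | EDim => true
  | EVar i => i < k
  | EAdd e1 e2 | EMul e1 e2 => scoped k e1 && scoped k e2
  end.

Definition copy (d x : nat) : cmd := Seq (Const d 0) (Op d Add x d).

(* The value ends up in register [d]; the registers above [d] hold
   intermediate values. *)
Fixpoint compile_expr (d : nat) (e : expr) : cmd :=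
  match e with
  | ENat k => Const d k
  | EDim => copy d 2
  | EVar i => copy d (i + 3)
  | EAdd e1 e2 =>
      Seq (Seq (compile_expr d e1) (compile_expr d.+1 e2)) (Op d Add d d.+1)
  | EMul e1 e2 =>
      Seq (Seq (compile_expr d e1) (compile_expr d.+1 e2)) (Op d Mul d d.+1)
  end.

Fixpoint registers (e : expr) : nat :=
  match e with
  | ENat _ | EDim | EVar _ => 1
  | EAdd e1 e2 | EMul e1 e2 => maxn (registers e1) (registers e2).+1
  end.

Fixpoint expr_time (e : expr) : nat :=
  match e with
  | ENat _ => 1
  | EDim | EVar _ => 2
  | EAdd e1 e2 | EMul e1 e2 => expr_time e1 + expr_time e2 + 1
  end.

Definition scratch (d : nat) (st st' : state) : Prop :=
  arr st' = arr st /\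
  forall y, (y < d) || (reg_shift <= y) -> reg st' y = reg st y.

Lemma scratch_set_reg d x v st :
  d <= x < reg_shift -> scratch d st (set_reg x v st).
Proof. by move=> dx; split=> //= y; case: eqP => // ->; lia. Qed.

Lemma scratch_trans d d' st1 st2 st3 : d <= d' ->
  scratch d st1 st2 -> scratch d' st2 st3 -> scratch d st1 st3.
Proof.
by move=> dd' [a1 r1] [a2 r2]; split=> [|y yd]; rewrite ?a2 // r2 ?r1 //; lia.
Qed.

Lemma scratch_same_below d st st' : scratch d st st' -> same_below d st st'.
Proof. by case=> a r; split=> [y yd|i]; rewrite ?a // r // yd. Qed.

Lemma scratch_embeds d sg st st' :
  scratch d st st' -> embeds sg st -> embeds sg st'.
Proof.
by move=> [a r] [er ea]; split=> [x|b i]; rewrite ?a // r // leq_addl orbT.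
Qed.

Lemma embeds_set_own_reg x v sg st :
  x < reg_shift -> embeds sg st -> embeds sg (set_reg x v st).
Proof.
by move=> xs [er ea]; split=> //= y; case: eqP => // yx; move: xs; lia.
Qed.

Lemma word_gt1 w : 0 < w -> 1 < 2 ^ w.
Proof. by rewrite -{2}(expn0 2) ltn_exp2l. Qed.

Lemma eval_binop_lt w x y : 0 < w -> eval_binop w Lt x y = (x < y).
Proof.
move=> w0; rewrite /eval_binop /wrap modn_small //.
by case: (x < y); have := word_gt1 w0; lia.
Qed.

Lemma eval_binop_or w (b c : bool) : 0 < w -> eval_binop w Or b c = b || c.
Proof.
move=> w0; have lorE : Nat.lor b c = b || c by case: b; case: c.
rewrite /eval_binop lorE /wrap modn_small //.
by case: (b || c); have := word_gt1 w0; lia.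
Qed.

Lemma eval_binop_sub w x y : y <= x < 2 ^ w -> eval_binop w Sub x y = x - y.
Proof.
move=> /andP[yx xw]; rewrite /eval_binop /wrap.
have -> : x + (2 ^ w - y) = x - y + 2 ^ w by lia.
by rewrite modnDr modn_small //; lia.
Qed.

Definition word_pair (w : nat) (e : nat * nat) : bool :=
  (e.1 < 2 ^ w) && (e.2 < 2 ^ w).

Local Notation next_reg env := (size env + 3).

Section Language.
Variables (w n : nat) (inp : nat -> nat).
Hypotheses (w_gt0 : 0 < w) (n_fits : n < 2 ^ w).

(* Register 1, the output, holds the result [b] found so far. *)
Definition own_memory (env : seq nat) (b : bool) (st : state) : Prop :=
  [/\ reg st 1 = b, reg st 2 = n,
      forall i, i < size env -> reg st (i + 3) = nth 0 env i
    & forall i, arr st 0 i = inp i].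

Lemma own_memory_same_below d env b st st' :
  next_reg env <= d -> same_below d st st' -> own_memory env b st ->
  own_memory env b st'.
Proof.
move=> sd [r a] [r1 r2 renv ra].
by split=> [||i ie|i]; rewrite ?a // r ?renv //; lia.
Qed.

Lemma own_memory_rcons env v b st :
  own_memory (rcons env v) b st <->
  own_memory env b st /\ reg st (next_reg env) = v.
Proof.
split=> [[r1 r2 renv ra]|[[r1 r2 renv ra] rv]]; last first.
  split=> // i; rewrite size_rcons nth_rcons.
  by case: (ltngtP i (size env)) => [/renv//| |->//]; lia.
split; last by rewrite renv ?size_rcons // nth_rcons ltnn eqxx.
by split=> // i ie; rewrite renv ?size_rcons ?nth_rcons ?ie //; lia.
Qed.

Lemma own_memory_set_output env b c st :
  own_memory env b st -> own_memory env c (set_reg 1 c st).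
Proof.
move=> [_ r2 renv ra]; split=> //= i ie; rewrite -renv //.
by case: eqP => //; lia.
Qed.

Lemma copy_runs d x st : x < d < reg_shift ->
  exists st', [/\ runs w (copy d x) st 2 st', scratch d st st'
    & reg st' d = reg st x %% 2 ^ w].
Proof.
move=> xd; set st1 := set_reg d (wrap w 0) st.
exists (set_reg d (eval_binop w Add (reg st1 x) (reg st1 d)) st1); split.
- apply: (@runs_seq _ _ _ _ 1 st1 1); first exact: runs_const.
  exact: runs_op.
- by apply: (@scratch_trans _ d _ st1) => //; apply: scratch_set_reg; lia.
rewrite /= !eqxx ifN; last by lia.
by rewrite /eval_binop /wrap mod0n addn0.
Qed.

Lemma compile_expr_runs e d env b st :
  scoped (size env) e -> next_reg env <= d -> d + registers e <= reg_shift ->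
  own_memory env b st ->
  exists st', [/\ runs w (compile_expr d e) st (expr_time e) st',
    scratch d st st' & reg st' d = eval n env e %% 2 ^ w].
Proof.
elim: e d st => [k||i|e1 IH1 e2 IH2|e1 IH1 e2 IH2] d st /= se sd rd ow.
- exists (set_reg d (wrap w k) st); split; first exact: runs_const.
    by apply: scratch_set_reg; lia.
  by rewrite /= eqxx.
- have [_ r2 _ _] := ow.
  have [|st' [r s v]] := @copy_runs d 2 st; first by lia.
  by exists st'; rewrite v r2.
- have [_ _ renv _] := ow.
  have [|st' [r s v]] := @copy_runs d (i + 3) st; first by lia.
  by exists st'; rewrite v renv.
all: have [se1 se2] := andP se.
all: have [||st1 [r1 s1 v1]] := IH1 d st se1 _ _ ow; [lia|lia|].
all: have ow1 := own_memory_same_below sd (scratch_same_below s1) ow.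
all: have [||st2 [r2 s2 v2]] := IH2 d.+1 st1 se2 _ _ ow1; [lia|lia|].
all: have v1' : reg st2 d = reg st1 d by case: s2 => _ ->; lia.
all: eexists; split; [exact: runs_seq (runs_seq r1 r2) (runs_op _ _ _ _ _ _)|
  apply: (scratch_trans (leqnn d) (scratch_trans (leqnSn d) s1 s2));
    apply: scratch_set_reg; lia|].
- by rewrite /= eqxx v1' v1 v2 /eval_binop /wrap modnDm.
- by rewrite /= eqxx v1' v1 v2 /eval_binop /wrap modnMm.
Qed.

Definition expr_fits (k : nat) (e : expr) : bool :=
  scoped k e && (k + 3 + registers e < reg_shift).

Lemma compile_expr_word_runs e env b st (d := next_reg env) :
  expr_fits (size env) e -> eval n env e < 2 ^ w -> own_memory env b st ->
  exists st', [/\ runs w (compile_expr d e) st (expr_time e) st',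
    scratch d st st' & reg st' d = eval n env e].
Proof.
move=> /andP[se rd] ew ow.
have [st1 [r1 sc1 v1]] := compile_expr_runs se (leqnn d) (ltnW rd) ow.
by exists st1; rewrite v1 modn_small.
Qed.

Definition pair_fits (k : nat) (p : expr * expr) : bool :=
  [&& scoped k p.1, scoped k p.2
    & k + 3 + maxn (registers p.1) (registers p.2).+1 <= reg_shift].

Definition compile_pair (d : nat) (p : expr * expr) : cmd :=
  Seq (compile_expr d p.1) (compile_expr d.+1 p.2).

Definition pair_time (p : expr * expr) : nat := expr_time p.1 + expr_time p.2.

Definition eval_pair (env : seq nat) (p : expr * expr) : nat * nat :=
  (eval n env p.1, eval n env p.2).

Lemma compile_pair_runs p env b st (d := next_reg env) :
  pair_fits (size env) p -> word_pair w (eval_pair env p) ->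
  own_memory env b st ->
  exists st', [/\ runs w (compile_pair d p) st (pair_time p) st',
    scratch d st st', reg st' d = (eval_pair env p).1
    & reg st' d.+1 = (eval_pair env p).2].
Proof.
move=> /and3P[s1 s2 rp] /andP[/= sm1 sm2] ow.
have [|st1 [r1 sc1 v1]] := compile_expr_runs s1 (leqnn d) _ ow.
  by rewrite /d; lia.
have ow1 := own_memory_same_below (leqnn d) (scratch_same_below sc1) ow.
have [|st2 [r2 sc2 v2]] := compile_expr_runs s2 (leqnSn d) _ ow1.
  by rewrite /d; lia.
exists st2; split.
- exact: runs_seq r1 r2.
- exact: scratch_trans sc1 sc2.
- by case: sc2 => _ -> //=; rewrite ?ltnSn // v1 modn_small.
- by rewrite v2 modn_small.
Qed.

(** * A structured language *)

Inductive term := Val of expr | Input of expr | Diff of expr & expr.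

Definition term_value (env : seq nat) (tm : term) : nat :=
  match tm with
  | Val e => eval n env e
  | Input e => inp (eval n env e)
  | Diff e1 e2 => eval n env e1 - eval n env e2
  end.

Definition term_fits (k : nat) (tm : term) : bool :=
  match tm with
  | Val e | Input e => expr_fits k e
  | Diff e1 e2 => pair_fits k (e1, e2)
  end.

Definition term_safe (env : seq nat) (tm : term) : bool :=
  match tm with
  | Val e | Input e => eval n env e < 2 ^ w
  | Diff e1 e2 => eval n env e2 <= eval n env e1 < 2 ^ w
  end.

Definition compile_term (d : nat) (tm : term) : cmd :=
  match tm with
  | Val e => compile_expr d e
  | Input e => Seq (compile_expr d e) (Read d 0 d)
  | Diff e1 e2 => Seq (compile_pair d (e1, e2)) (Op d Sub d d.+1)
  end.

Definition term_time (tm : term) : nat :=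
  match tm with
  | Val e => expr_time e
  | Input e => expr_time e + 1
  | Diff e1 e2 => pair_time (e1, e2) + 1
  end.

Lemma compile_term_runs tm env b st (d := next_reg env) :
  term_fits (size env) tm -> term_safe env tm -> own_memory env b st ->
  exists st', [/\ runs w (compile_term d tm) st (term_time tm) st',
    scratch d st st' & reg st' d = term_value env tm].
Proof.
have dS st1 v : d < reg_shift -> scratch d st1 (set_reg d v st1).
  by move=> rd; apply: scratch_set_reg; rewrite leqnn.
case: tm => [e|e|e1 e2] /= fit tm_safe ow.
- exact: compile_expr_word_runs ow.
- have [st1 [r1 sc1 v1]] := compile_expr_word_runs fit tm_safe ow.
  have [_ rd] := andP fit.
  eexists; split; first exact: runs_seq r1 (runs_read _ _ _ _ _).
    by apply: scratch_trans (leqnn d) sc1 (dS _ _ _); rewrite /d; lia.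
  by case: ow sc1 => _ _ _ inpE [-> _]; rewrite /= eqxx inpE v1.
have [_ _ rd] := and3P fit; have [e21 e1w] := andP tm_safe.
have [|st1 [r1 sc1 v1 v2]] := compile_pair_runs fit _ ow.
  by rewrite /word_pair /= e1w (leq_ltn_trans e21).
eexists; split; first exact: runs_seq r1 (runs_op _ _ _ _ _ _).
  apply: scratch_trans (leqnn d) sc1 (dS _ _ _).
  by move: rd; rewrite /d /=; lia.
by rewrite /= eqxx v1 v2 eval_binop_sub.
Qed.

(* Variables are scoped lexically: [env] lists their values, the latest one
   last, and a program does not change those that it starts with. *)
Inductive prog :=
  | Nop
  | Bind of term & prog
  | Then of prog & prog
  | Loop of prog                   (* a new variable runs from 0 to n - 1 *)
  | When of bool & nat & prog      (* the bit negates the test x != 0 *)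
  | Act of expr * expr
  | Ask of expr.

Fixpoint trace (p : prog) (env : seq nat) : seq request :=
  match p with
  | Nop => [::]
  | Bind tm p => trace p (rcons env (term_value env tm))
  | Then p1 p2 => trace p1 env ++ trace p2 env
  | Loop p => \big[cat/[::]]_(0 <= k < n) trace p (rcons env k)
  | When b x p => if (nth 0 env x != 0) (+) b then trace p env else [::]
  | Act e => [:: Update (eval_pair env e)]
  | Ask _ => [:: Query]
  end.

(* [verdict] gives the outcomes of the comparisons made by [Ask]; [safe] demands
   that they agree with every correct answer, and that all values fit into a
   word. *)
Variable verdict : seq nat -> bool.

Fixpoint found (p : prog) (env : seq nat) : bool :=
  match p with
  | Nop | Act _ => false
  | Bind tm p => found p (rcons env (term_value env tm))
  | Then p1 p2 => found p1 env || found p2 env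
  | Loop p => has (fun k => found p (rcons env k)) (index_iota 0 n)
  | When b x p => ((nth 0 env x != 0) (+) b) && found p env
  | Ask _ => verdict env
  end.

Variable answer : seq request -> nat -> Prop.

Fixpoint safe (p : prog) (env : seq nat) (past : seq request) : Prop :=
  match p with
  | Nop => True
  | Bind tm p =>
      term_safe env tm /\ safe p (rcons env (term_value env tm)) past
  | Then p1 p2 => safe p1 env past /\ safe p2 env (past ++ trace p1 env)
  | Loop p => forall k, k < n -> safe p (rcons env k)
      (past ++ \big[cat/[::]]_(0 <= l < k) trace p (rcons env l))
  | When b x p => (nth 0 env x != 0) (+) b -> safe p env past
  | Act e => word_pair w (eval_pair env e)
  | Ask e => eval n env e < 2 ^ w /\
      forall r, answer past r -> (r < eval n env e) = verdict env
  end.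

Fixpoint fits (k : nat) (p : prog) : bool :=
  match p with
  | Nop => true
  | Bind tm p => term_fits k tm && fits k.+1 p
  | Then p1 p2 => fits k p1 && fits k p2
  | Loop p => (k + 4 < reg_shift) && fits k.+1 p
  | When _ x p => (x < k) && fits k p
  | Act e => pair_fits k e && (k + 5 < reg_shift)
  | Ask e => expr_fits k e
  end.

(* [act d] performs an update with the edge in registers [d] and [d.+1], and
   [ask] a query; they are charged [call_time] steps on top of the time that
   the simulated algorithm takes. *)
Variables (act : nat -> cmd) (ask : cmd) (call_time : nat).

Definition step_index (d : nat) : cmd :=
  Seq (Const d.+1 1) (Seq (Op d Add d d.+1) (Op d.+1 Lt d 2)).

Fixpoint compile (d : nat) (p : prog) : cmd :=
  match p with
  | Nop => Skip
  | Bind tm p => Seq (compile_term d tm) (compile d.+1 p)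
  | Then p1 p2 => Seq (compile d p1) (compile d p2)
  | Loop p => Seq (Seq (Const d 0) (Op d.+1 Lt d 2))
      (While d.+1 (Seq (compile d.+1 p) (step_index d)))
  | When b x p =>
      If (x + 3) (if b then Skip else compile d p)
        (if b then compile d p else Skip)
  | Act e => Seq (compile_pair d e) (act d)
  | Ask e => Seq ask
      (Seq (compile_expr d e) (Seq (Op d Lt (1 + reg_shift) d) (Op 1 Or 1 d)))
  end.

Fixpoint time (m : nat) (p : prog) : nat :=
  match p with
  | Nop => 1
  | Bind tm p => term_time tm + time m p
  | Then p1 p2 => time m p1 + time m p2
  | Loop p => 3 + m * (time m p + 4)
  | When _ _ p => (time m p).+2
  | Act e => pair_time e + call_time
  | Ask e => call_time + (expr_time e + 2)
  end.

Fixpoint nesting (p : prog) : nat :=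
  match p with
  | Nop | Act _ | Ask _ => 0
  | Bind _ p | When _ _ p => nesting p
  | Then p1 p2 => maxn (nesting p1) (nesting p2)
  | Loop p => (nesting p).+1
  end.

Lemma time_polynomial m p : 0 < m -> time m p <= time 1 p * m ^ nesting p.
Proof.
move=> m0; have pow k : 0 < m ^ k by rewrite expn_gt0 m0.
have const c k : c <= c * m ^ k by rewrite leq_pmulr.
elim: p => [|tm p IH|p1 IH1 p2 IH2|p IH|b x p IH|e|e] /=; rewrite ?const //.
- by rewrite mulnDl leq_add.
- rewrite mulnDl leq_add //; [move: IH1|move: IH2] => /leq_trans; apply.
    by rewrite leq_mul2l leq_pexp2l ?leq_maxl ?orbT.
  by rewrite leq_mul2l leq_pexp2l ?leq_maxr ?orbT.
- rewrite mul1n mulnDl leq_add // expnS mulnCA leq_mul2l mulnDl.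
  by rewrite leq_add ?orbT.
- by rewrite -addn2 -[(time 1 p).+2]addn2 mulnDl leq_add.
Qed.

(* [amortized c st T B Q]: [T] is the time reserved for the requests that are
   still to come, and [B] bounds the time that [c] takes besides. *)
Definition amortized (c : cmd) (st : state) (T B : nat)
    (Q : nat -> state -> Prop) : Prop :=
  exists t T' st', [/\ runs w c st t st', t + T' <= T + B & Q T' st'].

Lemma amortized_seq c1 c2 st T B1 B2 Q :
  amortized c1 st T B1 (fun T1 st1 => amortized c2 st1 T1 B2 Q) ->
  amortized (Seq c1 c2) st T (B1 + B2) Q.
Proof.
move=> [t1 [T1 [st1 [r1 le1 [t2 [T2 [st2 [r2 le2 q]]]]]]]].
exists (t1 + t2), T2, st2; split=> //; first exact: runs_seq r1 r2.
by lia.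
Qed.

Lemma amortized_mono c st T B B' (Q Q' : nat -> state -> Prop) :
  B <= B' -> (forall T' st', Q T' st' -> Q' T' st') ->
  amortized c st T B Q -> amortized c st T B' Q'.
Proof.
move=> BB' QQ' [t [T' [st' [r le q]]]]; exists t, T', st'.
by split=> //; [lia|exact: QQ'].
Qed.

Lemma amortized_step c st t st' T (Q : nat -> state -> Prop) :
  runs w c st t st' -> Q T st' -> amortized c st T t Q.
Proof. by exists t, T, st'; rewrite addnC. Qed.

(* [Sim past rest T sg]: the simulated memory is [sg], the requests [past] have
   been made, and [rest] will be made in time [T]. *)
Variable Sim : seq request -> seq request -> nat -> state -> Prop.

Definition prog_inv (env : seq nat) (b : bool) (past rest : seq request)
    (T : nat) (st : state) : Prop :=
  exists sg, [/\ own_memory env b st, embeds sg st & Sim past rest T sg].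

Definition act_spec : Prop := forall d e past rest T sg st,
  d + 2 < reg_shift -> word_pair w e -> reg st d = e.1 ->
  reg st d.+1 = e.2 -> embeds sg st -> Sim past (Update e :: rest) T sg ->
  amortized (act d) st T call_time (fun T' st' => exists sg',
    [/\ same_below d st st', embeds sg' st'
      & Sim (rcons past (Update e)) rest T' sg']).

Definition ask_spec : Prop := forall past rest T sg st,
  embeds sg st -> Sim past (Query :: rest) T sg ->
  amortized ask st T call_time (fun T' st' => exists sg',
    [/\ same_below reg_shift st st', embeds sg' st',
        Sim (rcons past Query) rest T' sg' & answer past (reg sg' 1)]).

Hypotheses (act_ok : act_spec) (ask_ok : ask_spec).

Definition sound (p : prog) : Prop := forall env b past rest T st,
  fits (size env) p -> safe p env past ->
  prog_inv env b past (trace p env ++ rest) T st ->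
  amortized (compile (next_reg env) p) st T (time n p)
    (prog_inv env (b || found p env) (past ++ trace p env) rest).

Lemma prog_inv_scratch env b past rest T st st' :
  scratch (next_reg env) st st' -> prog_inv env b past rest T st ->
  prog_inv env b past rest T st'.
Proof.
move=> sc [sg [ow em r]]; exists sg; split=> //.
  exact: own_memory_same_below (leqnn _) (scratch_same_below sc) ow.
exact: scratch_embeds sc em.
Qed.

Lemma prog_inv_rcons env v b past rest T st :
  prog_inv (rcons env v) b past rest T st <->
  prog_inv env b past rest T st /\ reg st (next_reg env) = v.
Proof.
split=> [[sg [/own_memory_rcons[ow rv] em r]]|[[sg [ow em r]] rv]]; last first.
  by exists sg; split=> //; apply/own_memory_rcons.
by split=> //; exists sg.
Qed.

Lemma sound_nop : sound Nop.
Proof.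
move=> env b past rest T st _ _ st_inv; apply: amortized_step (runs_skip _ _) _.
by rewrite orbF cats0.
Qed.

Lemma sound_bind tm p : sound p -> sound (Bind tm p).
Proof.
move=> sp env b past rest T st /= /andP[ftm fp] [stm safe_p] st_inv.
have [sg [ow _ _]] := st_inv.
have [st1 [r1 sc1 v1]] := compile_term_runs ftm stm ow.
apply: amortized_seq; apply: amortized_step r1 _.
have := sp (rcons env (term_value env tm)) b past rest T st1.
rewrite size_rcons addSn => /(_ fp safe_p)[].
  by apply/prog_inv_rcons; split=> //; apply: prog_inv_scratch sc1 st_inv.
by move=> t [T' [st' [r le /prog_inv_rcons[]]]]; exists t, T', st'.
Qed.

Lemma sound_then p1 p2 : sound p1 -> sound p2 -> sound (Then p1 p2).
Proof.
move=> s1 s2 env b past rest T st /= /andP[f1 f2] [safe1 safe2].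
rewrite -catA => st_inv; apply: amortized_seq.
apply: amortized_mono (s1 _ _ _ _ _ _ f1 safe1 st_inv) => // T1 st1 st1_inv.
apply: amortized_mono (s2 _ _ _ _ _ _ f2 safe2 st1_inv) => // T2 st2.
by rewrite orbA catA.
Qed.

Lemma sound_when c x p : sound p -> sound (When c x p).
Proof.
move=> sp env b past rest T st /= /andP[xk fp] safe_p st_inv.
have [sg [[_ _ renv _] _ _]] := st_inv.
suff [t [T' [st' [r le q]]]] : amortized
    (if (nth 0 env x != 0) (+) c then compile (next_reg env) p else Skip)
    st T (time n p).+1
    (prog_inv env (b || ((nth 0 env x != 0) (+) c) && found p env)
      (past ++ (if (nth 0 env x != 0) (+) c then trace p env else [::])) rest).
  exists t.+1, T', st'; split=> //; last by lia.
  by apply: runs_if; rewrite renv //; case: (_ != _) r; case: (c).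
case: ifP safe_p st_inv => [_ safe_p|_ _] st_inv.
  by apply: amortized_mono (sp _ _ _ _ _ _ fp (safe_p isT) st_inv).
rewrite orbF cats0.
apply: (@amortized_mono _ _ _ 1 _ (prog_inv env b past rest)) => //.
exact: amortized_step (runs_skip _ _) st_inv.
Qed.

Lemma sound_act e : sound (Act e).
Proof.
move=> env b past rest T st /= /andP[fe de] esm [sg [ow em r]].
have [st1 [r1 sc1 v1 v2]] := compile_pair_runs fe esm ow.
apply: amortized_seq; apply: amortized_step r1 _.
have ow1 := own_memory_same_below (leqnn _) (scratch_same_below sc1) ow.
have := act_ok (e := eval_pair env e) _ esm v1 v2 (scratch_embeds sc1 em) r.
case=> [|t [T' [st' [r' le [sg' [same em' Sim']]]]]]; first by lia.
exists t, T', st'; split=> //; exists sg'; rewrite orbF cats1; split=> //.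
exact: own_memory_same_below (leqnn _) same ow1.
Qed.

Lemma sound_ask e : sound (Ask e).
Proof.
move=> env b past rest T st /= fe [ew ok] [sg [ow em r]].
have /andP[_ de] := fe; apply: amortized_seq.
apply: amortized_mono (ask_ok em r) => // T1 st1.
case=> sg1 [same1 em1 R1 /ok verdictE].
have ow1 : own_memory env b st1 by apply: own_memory_same_below same1 ow; lia.
have [st2 [r2 sc2 v2]] := compile_expr_word_runs fe ew ow1.
have ow2 := own_memory_same_below (leqnn _) (scratch_same_below sc2) ow1.
have answerE : reg st2 (1 + reg_shift) = reg sg1 1.
  by case: sc2 => _ ->; [case: em1 => ->|rewrite leq_addl orbT].
apply: amortized_seq; apply: amortized_step r2 _.
apply: amortized_step (runs_seq (runs_op _ _ _ _ _ _) (runs_op _ _ _ _ _ _)) _.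
set d := next_reg env in sc2 v2 *; rewrite answerE v2 eval_binop_lt // verdictE.
set st3 := set_reg d (verdict env) st2.
have sc3 : scratch d st2 st3 by apply: scratch_set_reg; rewrite /d; lia.
have ow3 := own_memory_same_below (leqnn d) (scratch_same_below sc3) ow2.
have -> : eval_binop w Or (reg st3 1) (reg st3 d) = b || verdict env.
  by case: ow3 => -> _ _ _; rewrite /= eqxx eval_binop_or.
exists sg1; rewrite cats1; split=> //; first exact: own_memory_set_output ow3.
exact/embeds_set_own_reg/(scratch_embeds sc3)/(scratch_embeds sc2).
Qed.

Lemma step_index_runs d k st : 2 < d -> d.+1 < reg_shift ->
  reg st d = k -> reg st 2 = n -> k < n ->
  exists st', [/\ runs w (step_index d) st 3 st', scratch d st st',
    reg st' d = k.+1 & reg st' d.+1 = (k.+1 < n)].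
Proof.
move=> d2 ds rk r2 kn.
set st1 := set_reg d.+1 (wrap w 1) st.
set st2 := set_reg d (eval_binop w Add (reg st1 d) (reg st1 d.+1)) st1.
set st3 := set_reg d.+1 (eval_binop w Lt (reg st2 d) (reg st2 2)) st2.
have dE : reg st2 d = k.+1.
  rewrite /= !eqxx ltn_eqF // rk /eval_binop /wrap (modn_small (word_gt1 _)) //.
  by rewrite addn1 modn_small //; lia.
have nE : reg st2 2 = n by rewrite /= !ltn_eqF // ltnW.
exists st3; split.
- apply: (@runs_seq _ _ _ _ 1 st1 2); first exact: runs_const.
  exact: runs_seq (runs_op _ _ _ _ _ _) (runs_op _ _ _ _ _ _).
- have sc x v st' : d <= x <= d.+1 -> scratch d st' (set_reg x v st').
    by move=> dx; apply: scratch_set_reg; lia.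
  have sc12 : scratch d st st2.
    by apply: (@scratch_trans d d _ st1) => //; apply: sc; lia.
  by apply: (@scratch_trans d d _ st2) => //; apply: sc; lia.
- by rewrite -dE; apply: ifN; rewrite ltn_eqF.
- by rewrite -dE -nE -(eval_binop_lt _ _ w_gt0) /st3 /= eqxx.
Qed.

Lemma sound_while p env b past rest k T st (d := next_reg env) :
  sound p -> d.+1 < reg_shift -> fits (size env).+1 p ->
  (forall l, l < n -> safe p (rcons env l)
     (past ++ \big[cat/[::]]_(0 <= l' < l) trace p (rcons env l'))) ->
  k <= n -> reg st d.+1 = (n - k < n) ->
  prog_inv (rcons env (n - k)) b
    (past ++ \big[cat/[::]]_(0 <= l < n - k) trace p (rcons env l))
    (\big[cat/[::]]_(n - k <= l < n) trace p (rcons env l) ++ rest) T st ->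
  amortized (While d.+1 (Seq (compile d.+1 p) (step_index d))) st T
    (1 + k * (time n p + 4))
    (prog_inv env
      (b || has (fun l => found p (rcons env l)) (index_iota (n - k) n))
      (past ++ \big[cat/[::]]_(0 <= l < n) trace p (rcons env l)) rest).
Proof.
move=> sp ds fp safe_p; set F := fun l => trace p (rcons env l).
elim: k b T st => [|k IH] b T st kn test st_inv.
  rewrite subn0 ltnn in test; rewrite subn0 in st_inv *.
  exists 1, T, st; rewrite /index_iota subnn orbF addnC; split=> //.
    exact: runs_while_end.
  move: st_inv; rewrite [\big[_/_]_(n <= _ < n) _]big_geq //.
  by case/prog_inv_rcons.
set l := n - k.+1 in test st_inv *; have ln : l < n by rewrite /l; lia.
have lE : n - k = l.+1 by rewrite /l; lia.
have := sp (rcons env l) b _ (\big[cat/[::]]_(l.+1 <= i < n) F i ++ rest) T st.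
rewrite size_rcons addSn => /(_ _ fp (safe_p l ln)) [].
  by move: st_inv; rewrite (big_ltn ln) -catA.
move=> t1 [T1 [st1 [r1 le1 /prog_inv_rcons[inv1 d1]]]].
have [_ [[_ n1 _ _] _ _]] := inv1.
have [|st2 [r2 sc2 d2 test2]] := step_index_runs _ ds d1 n1 ln.
  by rewrite /d addn3.
have inv2 : prog_inv (rcons env (n - k)) (b || found p (rcons env l))
    (past ++ \big[cat/[::]]_(0 <= i < n - k) F i)
    (\big[cat/[::]]_(n - k <= i < n) F i ++ rest) T1 st2.
  rewrite lE big_nat_recr //= catA; apply/prog_inv_rcons; split=> //.
  exact: prog_inv_scratch sc2 inv1.
have [||t2 [T2 [st3 [r3 le3 inv3]]]] := IH _ _ _ _ _ inv2; first by lia.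
  by rewrite test2 lE.
exists (t1 + 3 + t2).+1, T2, st3; split.
- by apply: runs_while_step (runs_seq r1 r2) r3; rewrite test ln.
- by move: le1 le3; rewrite mulSn; lia.
have -> : index_iota l n = l :: index_iota l.+1 n.
  by rewrite /index_iota -(subnSK ln).
by move: inv3; rewrite lE -orbA.
Qed.

Lemma sound_loop p : sound p -> sound (Loop p).
Proof.
move=> sp env b past rest T st /= /andP[ds fp] safe_p st_inv.
set d := next_reg env; set st1 := set_reg d (wrap w 0) st.
set st2 := set_reg d.+1 (eval_binop w Lt (reg st1 d) (reg st1 2)) st1.
have [_ [[_ rn _ _] _ _]] := st_inv.
have sc : scratch d st st2.
  by apply: (@scratch_trans d d _ st1) => //; apply: scratch_set_reg; lia.
apply: (@amortized_seq _ _ _ _ 2 (1 + n * (time n p + 4))).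
apply: amortized_step (runs_seq (runs_const _ _ _ _) (runs_op _ _ _ _ _ _)) _.
have := @sound_while p env b past rest n T st2 sp _ fp safe_p.
have d0 : reg st1 d = 0 by rewrite /st1 /= eqxx /wrap mod0n.
have n1 : reg st1 2 = n by rewrite -rn; apply: ifN; rewrite /d; lia.
rewrite subnn; apply=> //; first by rewrite /d in ds *; lia.
  have -> : (0 < n) = (reg st1 d < reg st1 2) by rewrite d0 n1.
  by rewrite -(eval_binop_lt _ _ w_gt0); apply: ifT; rewrite eqxx.
rewrite big_geq // cats0; apply/prog_inv_rcons; split.
  exact: prog_inv_scratch st_inv.
by rewrite -/d -d0; apply: ifN; rewrite ltn_eqF.
Qed.

Theorem compile_sound p : sound p.
Proof.
elim: p => [|tm p|p1 s1 p2|p|c x p|e|e].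
- exact: sound_nop.
- exact: sound_bind.
- exact: sound_then.
- exact: sound_loop.
- exact: sound_when.
- exact: sound_act.
- exact: sound_ask.
Qed.

End Language.

(** * The graph *)

Implicit Types A : nat -> nat -> bool.

(* The vertices form eight blocks of the same size.  A path from s to t visits
   them in order: block 0 is a path starting at s, and block 7 a path ending at
   t; in the blocks between, column [j] is the path of the [vertex n b (x * n +
   j)] with [x <= n].  Blocks 1, 3 and 5 hold the first, second and third vertex
   of a triangle at the heads of their columns, the rest of these columns being
   dead ends that keep the number of vertices below the number of edges; block 6
   holds the first vertex again. *)
Definition block_size (n : nat) : nat := n * n.+1.

Definition vertex (n b o : nat) : nat := b * block_size n + o.

Definition num_vertices (n : nat) : nat := 8 * block_size n.

Definition target (n : nat) : nat := vertex n 7 (n * n).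

Definition path_edge (n b c : nat) : nat * nat :=
  (vertex n b c, vertex n b c.+1).

Definition column_edge (n b x j : nat) : nat * nat :=
  (vertex n b (x * n + j), vertex n b (x.+1 * n + j)).

(* An edge is present for every [x] and [j], so that the number of edges does
   not depend on [A]; without [A x j] it enters the column one step early. *)
Definition arc A (n l x j : nat) : nat * nat :=
  (vertex n l.*2.+1 x, vertex n l.*2.+2 (A x j * n + j)).

Definition gate (n l x j : nat) : nat * nat :=
  (vertex n l.*2.+2 (x.+1 * n + j), vertex n l.*2.+3 j).

Definition start_link (n x j : nat) : nat * nat :=
  (vertex n 0 (x * n + j), vertex n 1 j).

Definition end_link (n x j : nat) : nat * nat :=
  (vertex n 6 (n + j), vertex n 7 (n * n - (x * n + j))).

(* The position of an edge in this list is the sum of the blocks of its two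
   endpoints. *)
Definition cell_edges A (n x j : nat) : seq (nat * nat) :=
  [:: path_edge n 0 (x * n + j); start_link n x j;
      column_edge n 1 x j; arc A n 0 x j; column_edge n 2 x j; gate n 0 x j;
      column_edge n 3 x j; arc A n 1 x j; column_edge n 4 x j; gate n 1 x j;
      column_edge n 5 x j; arc A n 2 x j; column_edge n 6 x j; end_link n x j;
      path_edge n 7 (x * n + j)].

Definition edge A (n c x j : nat) : nat * nat :=
  nth (0, 0) (cell_edges A n x j) c.

Definition cells (n : nat) : seq (nat * nat) :=
  [seq (x, j) | x <- index_iota 0 n, j <- index_iota 0 n].

Definition edges_of A (n : nat) (kinds : seq nat) :
    seq (nat * nat) :=
  [seq edge A n c p.1 p.2 | p <- cells n, c <- kinds].

Definition fixed_kinds : seq nat := [:: 0; 2; 3; 4; 6; 7; 8; 10; 11; 12; 14].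
Definition link_kinds : seq nat := [:: 1; 5; 9; 13].

Definition fixed_edges A n := edges_of A n fixed_kinds.
Definition links A n := edges_of A n link_kinds.

Definition num_edges (n : nat) : nat := 15 * (n * n).

Lemma vertexK n b o : o < block_size n ->
  (vertex n b o %/ block_size n = b) * (vertex n b o %% block_size n = o).
Proof.
move=> ob; have s0 : 0 < block_size n by exact: leq_ltn_trans ob.
by rewrite /vertex divnMDl // modnMDl divn_small // modn_small // addn0.
Qed.

Lemma vertex_lt n b o b' o' : o < block_size n ->
  (b < b') || (b == b') && (o < o') -> vertex n b o < vertex n b' o'.
Proof.
rewrite /vertex => ob /orP[bb'|/andP[/eqP-> oo']]; last by rewrite ltn_add2l.
apply: leq_trans (leq_addr o' _).
apply: leq_trans (_ : b.+1 * block_size n <= _).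
  by rewrite mulSn addnC ltn_add2r.
by rewrite leq_mul2r bb' orbT.
Qed.

Lemma cell_lt n x j : x < n -> j < n -> x * n + j < n * n.
Proof. by nia. Qed.

Lemma column_lt n x j : x <= n -> j < n -> x * n + j < block_size n.
Proof. by rewrite /block_size mulnS; nia. Qed.

Lemma path_lt n c : 0 < n -> c <= n * n -> c < block_size n.
Proof. by rewrite /block_size mulnS; lia. Qed.

Lemma row_col n x j : j < n ->
  ((x * n + j) %/ n = x) * ((x * n + j) %% n = j).
Proof.
by move=> jn; rewrite divnMDl ?modnMDl ?divn_small ?modn_small ?addn0 //; lia.
Qed.

Definition edge_kind (n : nat) (e : nat * nat) : nat :=
  e.1 %/ block_size n + e.2 %/ block_size n.

Lemma offsets_lt A n x j : x < n -> j < n ->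
  [/\ (x * n + j).+1 < block_size n, x.+1 * n + j < block_size n,
      x < block_size n, j < block_size n & A x j * n + j < block_size n].
Proof.
move=> xn jn; have cn := cell_lt xn jn; have n0 : 0 < n by lia.
split; [apply: path_lt|apply: column_lt| | |apply: column_lt] => //.
- by rewrite /block_size mulnS; lia.
- by rewrite /block_size mulnS; lia.
- by case: (A x j) => //=; lia.
Qed.

Lemma edge_vertices A n c x j : c < 15 -> x < n -> j < n ->
  exists b o b' o', [/\ edge A n c x j = (vertex n b o, vertex n b' o'),
    b + b' = c, b' < 8, o < block_size n /\ o' < block_size n
    & (b < b') || (b == b') && (o < o')].
Proof.
move=> c15 xn jn; have [pS cS xb jb ab] := offsets_lt A xn jn.
have n0 : 0 < n by lia.
have c0 : x * n + j < x.+1 * n + j by rewrite mulSn; lia.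
have co : x * n + j < block_size n by exact: ltnW.
have nj : n + j < block_size n by rewrite -{1}[n]mul1n column_lt.
have nn : n * n - (x * n + j) < block_size n by apply: path_lt; lia.
do 15 (case: c c15 => [_|c c15];
  first by do 4 eexists; split=> //=; rewrite ?ltnSn ?c0).
by [].
Qed.

Lemma edge_kindE A n c x j :
  c < 15 -> x < n -> j < n -> edge_kind n (edge A n c x j) = c.
Proof.
move=> c15 xn jn.
have [b [o [b' [o' [-> <- _ [ob ob'] _]]]]] := edge_vertices A c15 xn jn.
by rewrite /edge_kind /= !vertexK.
Qed.

Lemma vertex_inj n b o b' o' : o < block_size n -> o' < block_size n ->
  vertex n b o = vertex n b' o' -> b = b' /\ o = o'.
Proof.
by move=> ob ob' eq; split; [rewrite -(vertexK b ob).1 eq vertexK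
  |rewrite -(vertexK b ob).2 eq vertexK].
Qed.

Lemma row_col_inj n x j x' j' : j < n -> j' < n ->
  x * n + j = x' * n + j' -> x = x' /\ j = j'.
Proof.
by move=> jn jn' eq; split; [rewrite -(row_col x jn).1 eq row_col
  |rewrite -(row_col x jn).2 eq row_col].
Qed.

Lemma edge_inj A n c x j x' j' :
  c < 15 -> x < n -> j < n -> x' < n -> j' < n ->
  edge A n c x j = edge A n c x' j' -> x = x' /\ j = j'.
Proof.
move=> c15 xn jn xn' jn'; have n0 : 0 < n by lia.
have cn := cell_lt xn jn; have cn' := cell_lt xn' jn'.
have [pS cS xb jb ab] := offsets_lt A xn jn.
have [pS' cS' xb' jb' ab'] := offsets_lt A xn' jn'.
have path b : path_edge n b (x * n + j) = path_edge n b (x' * n + j') ->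
    x = x' /\ j = j'.
  by case=> /(vertex_inj (ltnW pS) (ltnW pS'))[_ /row_col_inj[]].
have column b : column_edge n b x j = column_edge n b x' j' ->
    x = x' /\ j = j'.
  by case=> /(vertex_inj (ltnW pS) (ltnW pS'))[_ /row_col_inj[]].
have arc l : arc A n l x j = arc A n l x' j' -> x = x' /\ j = j'.
  case=> /(vertex_inj xb xb')[_ xx'] /(vertex_inj ab ab')[_ /row_col_inj[]] //.
have gate l : gate n l x j = gate n l x' j' -> x = x' /\ j = j'.
  by case=> /(vertex_inj cS cS')[_ /row_col_inj[]] // [->].
have start : start_link n x j = start_link n x' j' -> x = x' /\ j = j'.
  by case=> /(vertex_inj (ltnW pS) (ltnW pS'))[_ /row_col_inj[]].
have finish : end_link n x j = end_link n x' j' -> x = x' /\ j = j'.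
  have lt m : n * n - m < block_size n by apply: path_lt; rewrite ?leq_subr.
  case=> _ /(vertex_inj (lt _) (lt _))[_ eq].
  by apply: (@row_col_inj n) => //; lia.
by do 15 (case: c c15 => [_|c c15]; first by [apply: path|apply: column
  |apply: arc|apply: gate|apply: start|apply: finish]).
Qed.

Lemma mem_cells n p : (p \in cells n) = (p.1 < n) && (p.2 < n).
Proof.
case: p => x j; apply/allpairsP/andP => [[[x' j'] [/=]]|[/= xn jn]].
  by rewrite !mem_index_iota /= => xn jn [-> ->].
by exists (x, j); rewrite !mem_index_iota.
Qed.

Lemma edges_ofP A n ks e :
  reflect (exists c x j, [/\ c \in ks, x < n, j < n & e = edge A n c x j])
    (e \in edges_of A n ks).
Proof.
apply: (iffP allpairsP) => [[[[x j] c] [/= xj cks ->]]|].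
  by move: xj; rewrite mem_cells => /andP[xn jn]; exists c, x, j.
by case=> c [x [j [cks xn jn ->]]]; exists ((x, j), c); rewrite mem_cells xn jn.
Qed.

Lemma size_edges_of A n ks : size (edges_of A n ks) = n * n * size ks.
Proof. by rewrite !size_allpairs !size_iota subn0. Qed.

Lemma uniq_cells n : uniq (cells n).
Proof.
by apply: allpairs_uniq => [||[x j] [x' j'] _ _ []-> ->]; rewrite ?iota_uniq.
Qed.

Lemma uniq_edges_of A n ks :
  uniq ks -> all (fun c => c < 15) ks -> uniq (edges_of A n ks).
Proof.
move=> uks /allP ks15; apply: allpairs_uniq => //; first exact: uniq_cells.
have in_range p c : (p, c) \in [seq (p', c') | p' <- cells n, c' <- ks] ->
    [/\ c < 15, p.1 < n & p.2 < n].
  case/allpairsP=> [[p' c'] /= [pn cks [-> ->]]].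
  by move: pn; rewrite mem_cells => /andP[]; split=> //; apply: ks15.
move=> [[x j] c] [[x' j'] c'].
move=> /in_range[c15 xn jn] /in_range[c15' xn' jn'] /= eq.
have cc' : c = c'.
  by rewrite -(edge_kindE A c15 xn jn) /= eq edge_kindE.
by subst c'; have [/= -> ->] := edge_inj c15 xn jn xn' jn' eq.
Qed.

Lemma uniq_edges A n : uniq (fixed_edges A n ++ links A n).
Proof.
rewrite cat_uniq !uniq_edges_of //= andbT; apply/hasPn => e.
case/edges_ofP=> c [x [j [cl xn jn ->]]]; apply/negP.
case/edges_ofP=> c' [x' [j' [cf xn' jn' eq]]].
have lt15 k : k \in fixed_kinds ++ link_kinds -> k < 15.
  by apply/allP: k.
have cc' : c = c'.
  rewrite -(@edge_kindE A n c x j) ?lt15 ?mem_cat ?cl ?orbT //.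
  by rewrite eq edge_kindE // lt15 // mem_cat cf.
by move: cf; rewrite -cc'; apply/negP; move: (c) cl; apply/allP.
Qed.

Lemma edge_bounds A n e : e \in fixed_edges A n ++ links A n ->
  (e.1 < e.2) && (e.2 < num_vertices n).
Proof.
move=> e_in; have [c [x [j [c15 xn jn ->]]]] :
    exists c x j, [/\ c < 15, x < n, j < n & e = edge A n c x j].
  move: e_in; rewrite mem_cat => /orP[] /edges_ofP[c [x [j [cks xn jn ->]]]];
    exists c, x, j; split=> //; move: c cks; exact/allP.
have [b [o [b' [o' [-> _ b8 [ob ob'] lt]]]]] := edge_vertices A c15 xn jn.
rewrite vertex_lt //= /num_vertices -[8 * _]addn0 -/(vertex n 8 0).
by rewrite vertex_lt ?b8.
Qed.

(** * Distances *)

Lemma walk_nil directed E x : walk directed E x x 0.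
Proof. by exists [::]. Qed.

Lemma walk_cat directed E x y z k l :
  walk directed E x y k -> walk directed E y z l ->
  walk directed E x z (k + l).
Proof.
case=> p [p1 p2 p3] [q [q1 q2 q3]]; exists (p ++ q).
by rewrite cat_path last_cat size_cat p1 p2 q1 q2 p3 q3.
Qed.

Lemma walk_rcons directed E x y z l :
  walk directed E x y l -> (y, z) \in E -> walk directed E x z l.+1.
Proof.
case=> p [p1 p2 p3] yz; exists (rcons p z).
by rewrite rcons_path last_rcons size_rcons p1 p2 p3 /adj yz.
Qed.

Lemma walk_iter directed E (f : nat -> nat) k l :
  (forall m, m < l -> (f (k + m), f (k + m).+1) \in E) ->
  walk directed E (f k) (f (k + l)) l.
Proof.
elim: l => [|l IH] h; first by rewrite addn0; apply: walk_nil.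
by rewrite addnS; apply: walk_rcons (IH _) (h _ _) => // m ml; apply/h/ltnW.
Qed.

Definition lipschitz (phi : nat -> nat) (e : nat * nat) : bool :=
  (phi e.1 <= (phi e.2).+1) && (phi e.2 <= (phi e.1).+1).

Lemma walk_lipschitz directed E phi x y l :
  {in E, forall e, lipschitz phi e} -> walk directed E x y l ->
  phi y <= phi x + l.
Proof.
move=> h [p [px <- <-]] {y l}; elim: p x px => [|y p IH] x /=.
  by rewrite addn0.
case/andP=> xy /IH; suff : phi y <= (phi x).+1 by lia.
by case/orP: xy => [/h/andP[]|/andP[_ /h/andP[]]].
Qed.

(* [q 0], [q 1] and [q 2] are the three vectors of a query. *)
Section Test.
Variables (A : nat -> nat -> bool) (n h i : nat) (q : nat -> nat -> bool).
Hypotheses (hn : h < n) (iN : i < n).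

Definition entered (X : pred nat) (j : nat) : bool :=
  has (fun x => X x && A x j) (index_iota 0 n).

Fixpoint reached (l : nat) : pred nat :=
  if l is l'.+1 then fun j => entered (reached l') j && q l j else pred1 i.

Definition triangle : bool := entered (reached 2) i.

Let start_time := h * n + i.

Definition reach_dist (l : nat) : nat := start_time.+1 + l * h.+2.

Definition test_bound : nat := 2 * start_time + 2 * h + 8.

(* The links that may exist while row [i] is tested at time [h]. *)
Variant current_link : nat * nat -> Prop :=
  | Current_start x j of x < n & j < n & start_time <= x * n + j :
      current_link (start_link n x j)
  | Current_end x j of x < n & j < n & start_time <= x * n + j :
      current_link (end_link n x j)
  | Current_gate l x j of l < 2 & x < n & j < n
      & (h < x) || (x == h) && q l.+1 j : current_link (gate n l x j).

Definition is_test_graph (E : seq (nat * nat)) : Prop :=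
  [/\ {subset fixed_edges A n <= E}, start_link n h i \in E,
      end_link n h i \in E,
      forall l j, l < 2 -> j < n -> q l.+1 j -> gate n l h j \in E
    & forall e, e \in E -> e \in fixed_edges A n \/ current_link e].

Let n_gt0 : 0 < n. Proof. by lia. Qed.

Lemma enteredP (X : pred nat) j :
  reflect (exists x, [/\ x < n, X x & A x j]) (entered X j).
Proof.
apply: (iffP hasP) => [[x]|[x [xn Xx Axj]]].
  by rewrite mem_index_iota => xn /andP[]; exists x.
by exists x; rewrite ?mem_index_iota ?Xx.
Qed.

Lemma triangleP :
  reflect (exists j k, [/\ j < n, k < n
             & [&& q 1 j, q 2 k, A i j, A j k & A k i]]) triangle.
Proof.
apply: (iffP (enteredP _ _)) => [[k [kn /= /andP[/enteredP[j [jn]]]]]|].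
  case/andP=> /enteredP[i' [_ /eqP-> Aij]] qj Ajk qk Aki.
  by exists j, k; rewrite qj qk Aij Ajk Aki.
case=> j [k [jn kn /and5P[qj qk Aij Ajk Aki]]]; exists k; split=> //=.
rewrite qk andbT; apply/enteredP; exists j; split=> //=.
by rewrite qj andbT; apply/enteredP; exists i; split=> /=.
Qed.

Section Walk.
Variables (directed : bool) (E : seq (nat * nat)).
Hypothesis fixed_sub : {subset fixed_edges A n <= E}.

Lemma mem_fixed c x j :
  c \in fixed_kinds -> x < n -> j < n -> edge A n c x j \in E.
Proof. by move=> cf xn jn; apply/fixed_sub/edges_ofP; exists c, x, j. Qed.

Lemma path_walk b k l : b = 0 \/ b = 7 -> k + l <= n * n ->
  walk directed E (vertex n b k) (vertex n b (k + l)) l.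
Proof.
move=> b07 kl; apply: (@walk_iter _ _ (vertex n b)) => m ml.
have xn : (k + m) %/ n < n by rewrite ltn_divLR //; lia.
have jn : (k + m) %% n < n by rewrite ltn_mod.
by case: b07 => ->; [have := @mem_fixed 0 _ _ isT xn jn
  |have := @mem_fixed 14 _ _ isT xn jn]; rewrite /edge /= /path_edge -divn_eq.
Qed.

Lemma column_walk l j k : l < 3 -> j < n -> k < n ->
  walk directed E (vertex n l.*2.+2 (1 * n + j))
    (vertex n l.*2.+2 (k.+1 * n + j)) k.
Proof.
move=> l3 jn kn.
apply: (@walk_iter _ _ (fun x => vertex n l.*2.+2 (x * n + j))) => m mk.
have mn : 1 + m < n by lia.
by case: l l3 => [|[|[|//]]] _;
  [apply: (@mem_fixed 4)|apply: (@mem_fixed 8)|apply: (@mem_fixed 12)].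
Qed.

Lemma mem_arc l x j : l < 3 -> x < n -> j < n -> arc A n l x j \in E.
Proof.
by case: l => [|[|[|//]]] _;
  [apply: (@mem_fixed 3)|apply: (@mem_fixed 7)|apply: (@mem_fixed 11)].
Qed.

Hypothesis start_in : start_link n h i \in E.
Hypothesis end_in : end_link n h i \in E.
Hypothesis gate_in :
  forall l j, l < 2 -> j < n -> q l.+1 j -> gate n l h j \in E.

Lemma entered_walk l j : l < 3 -> j < n ->
  (forall x, x < n -> reached l x ->
     walk directed E 0 (vertex n l.*2.+1 x) (reach_dist l)) ->
  entered (reached l) j ->
  walk directed E 0 (vertex n l.*2.+2 (1 * n + j)) (reach_dist l).+1.
Proof.
move=> l3 jn wk /enteredP[x [xn rx Axj]]; apply: walk_rcons (wk x xn rx) _.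
by have := mem_arc l3 xn jn; rewrite /arc Axj.
Qed.

Lemma reached_walk l x : l < 3 -> x < n -> reached l x ->
  walk directed E 0 (vertex n l.*2.+1 x) (reach_dist l).
Proof.
elim: l x => [|l IH] x l3 xn /=.
  move=> /eqP->; rewrite /reach_dist mul0n addn0; apply: walk_rcons start_in.
  by apply: (@path_walk 0 0); [left|apply/ltnW/cell_lt].
case/andP=> ent qx; have l2 : l < 3 by lia.
have := entered_walk l2 xn (fun y => IH y l2) ent.
have -> : reach_dist l.+1 = ((reach_dist l).+1 + h).+1.
  by rewrite /reach_dist; lia.
move=> /walk_cat/(_ (column_walk l2 xn hn)) wk.
by apply: walk_rcons wk _; apply: gate_in.
Qed.

Lemma triangle_walk : triangle -> walk directed E 0 (target n) test_bound.-1.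
Proof.
have aN := cell_lt hn iN; have wk l := @reached_walk 2 l isT.
move=> /(@entered_walk 2 i isT iN wk) {}wk.
have -> : test_bound.-1 = (reach_dist 2).+2 + start_time.
  by rewrite /test_bound /reach_dist; lia.
rewrite /target -{1}(subnK (ltnW aN)); apply: walk_cat (path_walk _ _);
  [|by right|by rewrite subnK // ltnW].
by apply: walk_rcons wk _; rewrite mul1n.
Qed.

End Walk.

Definition column_potential (y : nat) (good : bool) : nat :=
  if y is y'.+1 then minn (y' + ~~ good) h.+1 else 0.

(* A lower bound on the distance from s if there is no triangle: a vertex that
   is not reached gets one more than it would otherwise, and the truncations
   account for the links of later times. *)
Definition potential (v : nat) : nat :=
  let b := v %/ block_size n in let o := v %% block_size n in
  let l := b.-1./2 in
  if b == 0 then minn o start_time.+1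
  else if b == 7 then (reach_dist 2).+2 + (start_time.+1 - (n * n - o))
  else if odd b then reach_dist l + ~~ reached l (o %% n)
  else (reach_dist l).+1 +
    column_potential (o %/ n) (entered (reached l) (o %% n)).

Lemma potential_start c : c <= n * n ->
  potential (vertex n 0 c) = minn c start_time.+1.
Proof. by move=> cn; rewrite /potential !vertexK // path_lt. Qed.

Lemma potential_end c : c <= n * n ->
  potential (vertex n 7 c) = (reach_dist 2).+2 + (start_time.+1 - (n * n - c)).
Proof. by move=> cn; rewrite /potential !vertexK // path_lt. Qed.

Lemma potential_dead_end l x j : l < 3 -> x <= n -> j < n ->
  potential (vertex n l.*2.+1 (x * n + j)) = reach_dist l + ~~ reached l j.
Proof.
move=> l3 xn jn; rewrite /potential !vertexK ?column_lt // row_col //.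
by case: l l3 => [|[|[|]]].
Qed.

Lemma potential_exit l j : l < 3 -> j < n ->
  potential (vertex n l.*2.+1 j) = reach_dist l + ~~ reached l j.
Proof. by move=> l3; apply: (@potential_dead_end l 0). Qed.

Lemma potential_column l x j : l < 3 -> x <= n -> j < n ->
  potential (vertex n l.*2.+2 (x * n + j)) =
  (reach_dist l).+1 + column_potential x (entered (reached l) j).
Proof.
move=> l3 xn jn; rewrite /potential !vertexK ?column_lt // !row_col //.
by case: l l3 => [|[|[|]]].
Qed.

Lemma lipschitz_path b c : b = 0 \/ b = 7 -> c < n * n ->
  lipschitz potential (path_edge n b c).
Proof.
move=> b07 cn; have cn' := ltnW cn; rewrite /lipschitz /=.
case: b07 => ->; first by rewrite !potential_start //; lia.
by rewrite !potential_end //; lia.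
Qed.

Lemma lipschitz_exit l x j : l < 3 -> x < n -> j < n ->
  lipschitz potential (column_edge n l.*2.+1 x j).
Proof.
move=> l3 xn jn; rewrite /lipschitz /=.
by rewrite !potential_dead_end ?(ltnW xn) // leqnSn.
Qed.

Lemma lipschitz_column l x j : l < 3 -> x < n -> j < n ->
  lipschitz potential (column_edge n l.*2.+2 x j).
Proof.
move=> l3 xn jn; rewrite /lipschitz /= !potential_column ?(ltnW xn) //=.
by case: x {xn} => [|x] /=; case: (entered _ _) => /=; lia.
Qed.

Lemma lipschitz_arc l x j : l < 3 -> x < n -> j < n ->
  lipschitz potential (arc A n l x j).
Proof.
move=> l3 xn jn; rewrite /lipschitz /= potential_exit // potential_column //;
  last by case: (A x j).
case Axj: (A x j) => /=; last by case: (reached l x); lia.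
case rx: (reached l x) => /=; last by case: (entered _ _) => /=; lia.
by have -> : entered (reached l) j by [apply/enteredP; exists x]; lia.
Qed.

Lemma lipschitz_fixed : {in fixed_edges A n, forall e, lipschitz potential e}.
Proof.
move=> e /edges_ofP[c [x [j [cf xn jn ->]]]]; have cn := cell_lt xn jn.
suff /allP/(_ c cf) :
  all (fun k => lipschitz potential (edge A n k x j)) fixed_kinds by [].
rewrite /= /edge /= !lipschitz_arc // (lipschitz_path (or_introl erefl)) //.
rewrite (lipschitz_path (or_intror erefl)) // (@lipschitz_exit 0) //.
rewrite (@lipschitz_exit 1) // (@lipschitz_exit 2) // (@lipschitz_column 0) //.
by rewrite (@lipschitz_column 1) // (@lipschitz_column 2).
Qed.

Lemma same_row_or_later x j : x < n -> j < n ->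
  start_time <= x * n + j -> j = i \/ start_time < x * n + j.
Proof.
move=> xn jn; rewrite leq_eqVlt => /orP[/eqP eq|]; last by right.
by left; have [_ ->] := row_col_inj iN jn eq.
Qed.

Lemma lipschitz_gate l x j : l < 2 -> x < n -> j < n ->
  (h < x) || (x == h) && q l.+1 j -> lipschitz potential (gate n l x j).
Proof.
move=> l2 xn jn hx; rewrite /lipschitz /= potential_column ?(leqW l2) //.
rewrite -[l.*2.+3]/(l.+1.*2.+1) potential_exit //= /reach_dist mulSn.
case: (entered _ _) => /=; last by case: ltngtP hx => //=; lia.
case/orP: hx => [hx|/andP[/eqP-> ->]] /=; last by lia.
by case: (q _ _) => /=; lia.
Qed.

Lemma lipschitz_start x j : x < n -> j < n -> start_time <= x * n + j ->
  lipschitz potential (start_link n x j).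
Proof.
move=> xn jn ax; have cn := cell_lt xn jn.
rewrite /lipschitz /= potential_start ?(ltnW cn) //.
rewrite (@potential_exit 0) //= /reach_dist.
case: (same_row_or_later xn jn ax) => [ji|].
  by subst j; rewrite eqxx /=; lia.
by case: (j == i) => /=; lia.
Qed.

Lemma lipschitz_end x j : ~~ triangle -> x < n -> j < n ->
  start_time <= x * n + j -> lipschitz potential (end_link n x j).
Proof.
move=> no_tri xn jn ax; have cn := cell_lt xn jn.
have -> : end_link n x j =
    (vertex n 2.*2.+2 (1 * n + j), vertex n 7 (n * n - (x * n + j))).
  by rewrite mul1n.
rewrite /lipschitz [fst _]/= [snd _]/= potential_column //.
rewrite potential_end ?leq_subr // subKn ?(ltnW cn) //.
case: (same_row_or_later xn jn ax) => [ji|].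
  by subst j; rewrite (negbTE no_tri : entered (reached 2) i = false) /=; lia.
by case: (entered _ _) => /=; lia.
Qed.

Lemma no_triangle_walk directed E l : ~~ triangle ->
  (forall e, e \in E -> e \in fixed_edges A n \/ current_link e) ->
  walk directed E 0 (target n) l -> test_bound <= l.
Proof.
move=> no_tri sound /(walk_lipschitz (phi := potential)) wk.
have tE : potential (target n) = test_bound.
  by rewrite potential_end // /test_bound /reach_dist; lia.
have sE : potential 0 = 0 by rewrite (@potential_start 0) // min0n.
rewrite -tE -[l]add0n -sE; apply: wk => e /sound[/lipschitz_fixed //|].
case=> [x j xn jn|x j xn jn|k x j k2 xn jn].
- exact: lipschitz_start.
- exact: lipschitz_end.
- exact: lipschitz_gate.
Qed.

Lemma test_graph_dist directed E r : is_test_graph E ->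
  dist_answer directed (num_vertices n) 0 (target n) E r ->
  (r < test_bound) = triangle.
Proof.
move=> [fixed_sub start_in end_in gate_in sound] ans.
have [tri|no_tri] := boolP triangle.
  have wk := triangle_walk directed fixed_sub start_in end_in gate_in tri.
  by case: ans => [[_ /(_ _ wk)]|[_ /(_ _ wk)]] //; rewrite /test_bound; lia.
have ge l := @no_triangle_walk directed E l no_tri sound.
apply/negbTE; rewrite -leqNgt; case: ans => [[/ge //]|[-> _]].
have aN := cell_lt hn iN; rewrite /test_bound /num_vertices /block_size mulnS.
by move: aN; rewrite -/start_time; lia.
Qed.

End Test.

(** * The requests *)

Lemma mem_big_cat (T : eqType) (F : nat -> seq T) a b e :
  reflect (exists2 k, a <= k < b & e \in F k)
    (e \in \big[cat/[::]]_(a <= k < b) F k).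
Proof.
have -> : (e \in \big[cat/[::]]_(a <= k < b) F k) =
    has (fun k => e \in F k) (index_iota a b).
  elim: (index_iota a b) => [|k s IH]; first by rewrite big_nil.
  by rewrite big_cons mem_cat IH.
by apply: (iffP hasP) => -[k]; rewrite ?mem_index_iota => kab ek; exists k;
  rewrite ?mem_index_iota.
Qed.

Lemma size_big_cat_le (T : Type) (F : nat -> seq T) c n :
  (forall k, size (F k) <= c) ->
  size (\big[cat/[::]]_(0 <= k < n) F k) <= n * c.
Proof.
move=> Fc; rewrite (big_morph size (@size_cat T) (erefl : size [::] = 0)).
by rewrite -[n in _ <= n * c]subn0 -sum_nat_const_nat; apply: leq_sum.
Qed.

Definition updates (qs : seq request) : seq (nat * nat) :=
  pmap (fun r => if r is Update e then Some e else None) qs.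

Lemma updates_cat qs1 qs2 : updates (qs1 ++ qs2) = updates qs1 ++ updates qs2.
Proof. exact: pmap_cat. Qed.

Lemma updates_big_cat F a b :
  updates (\big[cat/[::]]_(a <= k < b) F k) =
  \big[cat/[::]]_(a <= k < b) updates (F k).
Proof. exact: (big_morph updates updates_cat). Qed.

Lemma size_updates_le qs : size (updates qs) <= size qs.
Proof. by rewrite size_pmap count_size. Qed.

(* Time runs backwards in the incremental case: the links appear there in the
   order opposite to the one in which they disappear in the decremental case. *)
Definition clock (md : mode) (n t : nat) : nat :=
  if md is Incremental then n - t.+1 else t.

Lemma clock_lt md n t : t < n -> clock md n t < n.
Proof. by case: md => /=; lia. Qed.

Lemma clockK md n t : t < n -> clock md n (clock md n t) = t.
Proof. by case: md => /=; lia. Qed.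

Definition is_dec (md : mode) : bool :=
  if md is Decremental then true else false.

Definition gate_requests (n h : nat) (q : nat -> nat -> bool) (b : bool)
    (l j : nat) : seq request :=
  if q l.+1 j (+) b then [:: Update (gate n l h j)] else [::].

Definition gate_phase (n h : nat) (q : nat -> nat -> bool) (b : bool) :
    seq request :=
  \big[cat/[::]]_(0 <= j < n)
    (gate_requests n h q b 0 j ++ gate_requests n h q b 1 j).

Definition link_requests (n h i : nat) : seq request :=
  [:: Update (start_link n h i); Update (end_link n h i)].

Definition test_requests (q : nat -> nat -> bool) (i : nat) : seq request :=
  if q 0 i then [:: Query] else [::].

Definition row_requests (md : mode) (n h : nat) (q : nat -> nat -> bool)
    (l : nat) : seq request :=
  let i := clock md n l in
  if is_dec md then test_requests q i ++ link_requests n h i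
  else link_requests n h i ++ test_requests q i.

Definition query_requests (md : mode) (n h : nat) (q : nat -> nat -> bool) :
    seq request :=
  gate_phase n h q (is_dec md) ++
  \big[cat/[::]]_(0 <= l < n) row_requests md n h q l ++
  gate_phase n h q (~~ is_dec md).

Section Schedule.
Variables (md : mode) (n : nat) (Q : nat -> nat -> nat -> bool).

Definition schedule (a b : nat) : seq request :=
  \big[cat/[::]]_(a <= t < b) query_requests md n (clock md n t) (Q t).

Definition before_test (t l : nat) : seq request :=
  let h := clock md n t in
  schedule 0 t ++ gate_phase n h (Q t) (is_dec md) ++
  \big[cat/[::]]_(0 <= k < l) row_requests md n h (Q t) k ++
  (if is_dec md then [::] else link_requests n h (clock md n l)).

Definition later_range (t : nat) : nat * nat :=
  if md is Incremental then (0, t) else (t.+1, n).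

(* The links present at the test of row [clock md n l] in query [t]. *)
Definition live_links (t l : nat) : seq (nat * nat) :=
  let h := clock md n t in
  updates (link_requests n h (clock md n l) ++
    \big[cat/[::]]_((later_range l).1 <= k < (later_range l).2)
      row_requests md n h (Q t) k ++
    gate_phase n h (Q t) false ++ schedule (later_range t).1 (later_range t).2).

Lemma clock_later t s :
  t < n -> (later_range t).1 <= s < (later_range t).2 ->
  clock md n t < clock md n s < n.
Proof. by rewrite /later_range; case: md => /=; lia. Qed.

Lemma mem_updates_row h q l e :
  (e \in updates (row_requests md n h q l)) =
  (e \in updates (link_requests n h (clock md n l))).
Proof.
by rewrite /row_requests /test_requests; case: md; case: ifP.
Qed.

Lemma mem_gate_requests h q b l j e :
  (e \in updates (gate_requests n h q b l j)) =
  (q l.+1 j (+) b) && (e == gate n l h j).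
Proof. by rewrite /gate_requests; case: ifP => _; rewrite ?inE. Qed.

Lemma mem_gate_phase h q b e :
  reflect (exists l j, [/\ l < 2, j < n, q l.+1 j (+) b & e = gate n l h j])
    (e \in updates (gate_phase n h q b)).
Proof.
rewrite updates_big_cat; apply: (iffP (mem_big_cat _ _ _ _)) => [[j /= jn]|].
  rewrite updates_cat mem_cat !mem_gate_requests.
  by case/orP=> /andP[qb /eqP->]; [exists 0, j|exists 1, j].
case=> l [j [l2 jn qb ->]]; exists j => //.
rewrite updates_cat mem_cat !mem_gate_requests.
by case: l l2 qb => [|[|//]] _ ->; rewrite eqxx ?orbT.
Qed.

Lemma mem_updates_query A h q e : h < n ->
  reflect (exists c j, [/\ c \in link_kinds, j < n & e = edge A n c h j])
    (e \in updates (query_requests md n h q)).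
Proof.
move=> hn; rewrite !updates_cat !mem_cat updates_big_cat.
apply: (iffP or3P).
  have gates b : e \in updates (gate_phase n h q b) ->
      exists c j, [/\ c \in link_kinds, j < n & e = edge A n c h j].
    case/mem_gate_phase=> l [j [l2 jn _ ->]].
    by case: l l2 => [|[|//]] _; [exists 5, j|exists 9, j].
  case=> [/gates //|/mem_big_cat[l /= ln]|/gates //].
  rewrite mem_updates_row !inE => /orP[]/eqP->; [exists 1|exists 13];
    by exists (clock md n l); rewrite clock_lt.
case=> c [j [cl jn ->]].
have gates l : l < 2 ->
    [\/ gate n l h j \in updates (gate_phase n h q (is_dec md)),
        gate n l h j \in \big[cat/[::]]_(0 <= k < n)
           updates (row_requests md n h q k)
      | gate n l h j \in updates (gate_phase n h q (~~ is_dec md))].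
  by move=> l2; case: (boolP (q l.+1 j (+) is_dec md)) => qb;
    [apply: Or31|apply: Or33]; apply/mem_gate_phase; exists l, j;
    rewrite ?addbN.
have rows e' : e' \in updates (link_requests n h j) ->
    e' \in \big[cat/[::]]_(0 <= k < n) updates (row_requests md n h q k).
  move=> e'j; apply/mem_big_cat; exists (clock md n j); rewrite ?clock_lt //.
  by rewrite mem_updates_row clockK.
move: cl; rewrite !inE => /or4P[]/eqP->; [|exact: gates|exact: gates|].
  by apply: Or32; apply: rows; rewrite inE eqxx.
by apply: Or32; apply: rows; rewrite !inE eqxx orbT.
Qed.

Lemma later_link_current A h i q c x j : c \in link_kinds ->
  h < x < n -> i < n -> j < n -> current_link n h i q (edge A n c x j).
Proof.
move=> cl /andP[hx xn] iN jn.
have time : h * n + i <= x * n + j.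
  have : h.+1 * n <= x * n by rewrite leq_mul2r hx orbT.
  by rewrite mulSn; lia.
by move: cl; rewrite !inE => /or4P[]/eqP->; constructor; rewrite ?hx.
Qed.

Lemma live_links_current t l : t < n -> l < n ->
  {in live_links t l,
    forall e, current_link n (clock md n t) (clock md n l) (Q t) e}.
Proof.
move=> tn ln e; have hn := clock_lt md tn; have iN := clock_lt md ln.
rewrite /live_links !updates_cat !mem_cat => /or4P[].
- by rewrite !inE => /orP[]/eqP->; constructor.
- rewrite updates_big_cat => /mem_big_cat[k /(clock_later ln) /andP[ik kn]].
  rewrite mem_updates_row !inE => /orP[]/eqP->; constructor=> //;
    by rewrite leq_add2l ltnW.
- case/mem_gate_phase=> k [j [k2 jn]]; rewrite addbF => qk ->.
  by constructor; rewrite // eqxx qk orbT.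
rewrite updates_big_cat => /mem_big_cat[s /(clock_later tn) hs].
have [_ sn] := andP hs.
case/(@mem_updates_query (fun _ _ => false) _ _ _ sn) => c [j [cl jn ->]].
exact: later_link_current.
Qed.

Lemma start_link_live t l :
  start_link n (clock md n t) (clock md n l) \in live_links t l.
Proof. by rewrite /live_links updates_cat mem_cat inE eqxx. Qed.

Lemma end_link_live t l :
  end_link n (clock md n t) (clock md n l) \in live_links t l.
Proof. by rewrite /live_links updates_cat mem_cat !inE eqxx orbT. Qed.

Lemma gate_live t l k j : k < 2 -> j < n -> Q t k.+1 j ->
  gate n k (clock md n t) j \in live_links t l.
Proof.
move=> k2 jn qk; rewrite /live_links !updates_cat !mem_cat; apply/or4P/Or43.
by apply/mem_gate_phase; exists k, j; rewrite addbF.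
Qed.

Lemma links_scheduled A : {subset links A n <= updates (schedule 0 n)}.
Proof.
move=> e /edges_ofP[c [x [j [cl xn jn ->]]]]; rewrite updates_big_cat.
apply/mem_big_cat; exists (clock md n x); rewrite ?clock_lt // clockK //.
by apply/(mem_updates_query A _ _ xn); exists c, j.
Qed.

Lemma size_gate_phases h q b :
  size (gate_phase n h q b) + size (gate_phase n h q (~~ b)) = n * 2.
Proof.
have sizeE c : size (gate_phase n h q c) =
    \sum_(0 <= j < n) ((q 1 j (+) c) + (q 2 j (+) c)).
  rewrite (big_morph size (@size_cat request) (erefl : size [::] = 0)).
  by apply: eq_bigr => j _; rewrite size_cat /gate_requests; do 2 case: ifP.
rewrite !sizeE -big_split /=.
rewrite (eq_bigr (fun=> 2)) => [|j _]; first by rewrite sum_nat_const_nat subn0.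
by case: (q 1 j); case: (q 2 j); case: b.
Qed.

Lemma size_row_requests h q l : size (row_requests md n h q l) <= 3.
Proof. by rewrite /row_requests /test_requests; case: md; case: ifP. Qed.

Lemma size_schedule : size (schedule 0 n) <= n * (n * 5).
Proof.
apply: size_big_cat_le => t; rewrite !size_cat addnCA.
have := size_gate_phases (clock md n t) (Q t) (is_dec md).
have := size_big_cat_le n (size_row_requests (clock md n t) (Q t)).
by lia.
Qed.

Lemma size_updates_schedule : size (updates (schedule 0 n)) <= n * (n * 4).
Proof.
rewrite updates_big_cat; apply: size_big_cat_le => t; set h := clock md n t.
rewrite !updates_cat !size_cat updates_big_cat.
have := size_gate_phases h (Q t) (is_dec md).
have := size_updates_le (gate_phase n h (Q t) (is_dec md)).
have := size_updates_le (gate_phase n h (Q t) (~~ is_dec md)).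
have : size (\big[cat/[::]]_(0 <= l < n) updates (row_requests md n h (Q t) l))
    <= n * 2.
  apply: size_big_cat_le => l.
  by rewrite /row_requests /test_requests; case: md; case: ifP.
by lia.
Qed.

Lemma perm_updates_schedule A :
  perm_eq (updates (schedule 0 n)) (links A n).
Proof.
have uL : uniq (links A n) by exact: uniq_edges_of.
have sz : size (updates (schedule 0 n)) <= size (links A n).
  by rewrite size_edges_of -mulnA; apply: size_updates_schedule.
have [_ eqL] := uniq_min_size uL (@links_scheduled A) sz.
rewrite perm_sym; apply: uniq_perm => //.
exact: leq_size_uniq uL (@links_scheduled A) sz.
Qed.

Lemma schedule_before_test t l : t < n -> l < n ->
  exists rest, schedule 0 n =
    before_test t l ++ test_requests (Q t) (clock md n l) ++ rest /\
    (md = Decremental -> updates rest =i live_links t l).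
Proof.
move=> tn ln; set h := clock md n t; set i := clock md n l.
have scheduleE : schedule 0 n =
    schedule 0 t ++ query_requests md n h (Q t) ++ schedule t.+1 n.
  by rewrite /schedule -big_ltn // -big_cat_nat // ltnW.
have rowsE : \big[cat/[::]]_(0 <= k < n) row_requests md n h (Q t) k =
    \big[cat/[::]]_(0 <= k < l) row_requests md n h (Q t) k ++
    row_requests md n h (Q t) l ++
    \big[cat/[::]]_(l.+1 <= k < n) row_requests md n h (Q t) k.
  by rewrite -big_ltn // -big_cat_nat // ltnW.
have rowE : row_requests md n h (Q t) l =
    (if is_dec md then [::] else link_requests n h i) ++
    test_requests (Q t) i ++ (if is_dec md then link_requests n h i else [::]).
  by rewrite /row_requests; case: is_dec; rewrite ?cats0.
exists ((if is_dec md then link_requests n h i else [::]) ++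
  \big[cat/[::]]_(l.+1 <= k < n) row_requests md n h (Q t) k ++
  gate_phase n h (Q t) (~~ is_dec md) ++ schedule t.+1 n); split.
  by rewrite scheduleE /query_requests rowsE rowE /before_test -!catA.
by rewrite /live_links /later_range -/h -/i; case: md.
Qed.

End Schedule.

Definition initial_edges (md : mode) A (n : nat) : seq (nat * nat) :=
  fixed_edges A n ++ (if is_dec md then links A n else [::]).

Lemma mem_foldl_incremental E qs :
  foldl (next_graph Incremental) E qs =i updates qs ++ E.
Proof.
elim: qs E => //= -[e|] qs IH E e'; rewrite IH //.
by rewrite inE !mem_cat inE orbCA.
Qed.

Lemma mem_foldl_decremental E qs : uniq E ->
  foldl (next_graph Decremental) E qs =i [predD E & updates qs].
Proof.
elim: qs E => //= -[e|] qs IH E uE e'; rewrite IH ?rem_uniq //.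
by rewrite !inE /= mem_rem_uniq // inE negb_or -andbA andbCA.
Qed.

Lemma legal_incremental directed N m E qs :
  uniq (updates qs ++ E) -> all (is_edge directed N) (updates qs) ->
  size (updates qs ++ E) <= m -> legal directed Incremental N m E qs.
Proof.
elim: qs E => //= -[e|] qs IH E; last exact: IH.
rewrite /= size_cat mem_cat negb_or.
case/andP=> /andP[eU eE] u /andP[-> eqs] sm; rewrite eE /=.
apply/andP; split; first by lia.
apply: IH => //; last by rewrite size_cat /=; lia.
by rewrite -cat_rcons cat_uniq -cats1 -cat_uniq -catA uniq_catCA /= mem_cat
  negb_or eU eE.
Qed.

Lemma legal_decremental directed N m E qs :
  uniq E -> uniq (updates qs) -> {subset updates qs <= E} ->
  legal directed Decremental N m E qs.
Proof.
elim: qs E => //= -[e|] qs IH E; last exact: IH.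
move=> uE /= /andP[eU u] sE; rewrite sE ?mem_head //=.
apply: IH => //; first exact: rem_uniq.
move=> e' e'U; rewrite mem_rem_uniq // inE sE ?inE ?e'U ?orbT // andbT.
by apply: contraNneq eU => <-.
Qed.

Lemma size_fixed_links A n :
  size (fixed_edges A n ++ links A n) = num_edges n.
Proof. by rewrite size_cat !size_edges_of /num_edges /=; lia. Qed.

Lemma schedule_instance directed md A n Q : 0 < n ->
  is_instance directed md (num_vertices n) (num_edges n) 0 (target n)
    (initial_edges md A n) (schedule md n Q 0 n).
Proof.
move=> n0; have pU := perm_updates_schedule md n Q A.
have uE := uniq_edges A n; have sE := size_fixed_links A n.
have edges :
    all (is_edge directed (num_vertices n)) (fixed_edges A n ++ links A n).
  apply/allP => e /edge_bounds /andP[e12 eN].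
  rewrite /is_edge eN (ltn_trans e12) //=.
  by case: directed; rewrite ?neq_ltn e12.
have [eF eL] : all (is_edge directed (num_vertices n)) (fixed_edges A n) /\
    all (is_edge directed (num_vertices n)) (links A n).
  by apply/andP; rewrite -all_cat.
have [uF uL] : uniq (fixed_edges A n) /\ uniq (links A n).
  by move: uE; rewrite cat_uniq => /and3P[].
have size_gt0 : 0 < block_size n by rewrite muln_gt0 n0.
apply/and5P; split; last (apply/andP; split).
- rewrite /initial_edges /is_graph.
  by case: md {pU}; rewrite ?cats0 ?eF // edges.
- by rewrite muln_gt0.
- rewrite /target /num_vertices -[8 * _]addn0 -/(vertex n 8 0).
  by apply: vertex_lt => //; apply: path_lt.
- by rewrite /num_vertices /num_edges /block_size mulnS; nia.
- by case: md {pU}; rewrite /initial_edges ?cats0 ?sE // -sE size_cat leq_addr.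
case: md pU => pU; rewrite /initial_edges ?cats0.
  apply: legal_incremental; last first.
  - by rewrite size_cat (perm_size pU) addnC -size_cat sE.
  - by rewrite (perm_all _ pU).
  - by rewrite uniq_catC (perm_uniq (perm_cat (perm_refl _) pU)).
apply: legal_decremental => //; first by rewrite (perm_uniq pU).
by move=> e; rewrite (perm_mem pU) mem_cat => ->; rewrite orbT.
Qed.

Lemma before_test_graph md A n Q t l : t < n -> l < n ->
  foldl (next_graph md) (initial_edges md A n) (before_test md n Q t l) =i
  fixed_edges A n ++ live_links md n Q t l.
Proof.
move=> tn ln e.
have [rest [scheduleE restE]] := schedule_before_test md Q tn ln.
have pU := perm_updates_schedule md n Q A; have uE := uniq_edges A n.
case: md rest scheduleE restE pU => rest scheduleE restE pU.
  rewrite mem_foldl_incremental /initial_edges /= cats0 !mem_cat orbC.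
  congr (_ || _).
  rewrite /before_test /live_links !updates_cat !mem_cat /=.
  by do 4 (case: (e \in _); rewrite ?orbT //).
move: (before_test _ _ _ _ _) scheduleE => before scheduleE.
rewrite mem_foldl_decremental // inE /=.
move: uE; rewrite -(perm_uniq (perm_cat (perm_refl _) pU)).
rewrite -(perm_mem (perm_cat (perm_refl _) pU)) scheduleE !updates_cat !mem_cat.
have -> : updates (test_requests (Q t) (clock Decremental n l)) = [::].
  by rewrite /test_requests; case: ifP.
rewrite cat0s restE // uniq_catCA cat_uniq => /and3P[_ /hasPn dis _].
case: (boolP (e \in updates before)) => [eB|_] //=.
apply/esym/negbTE; apply: contraL eB => eR.
by apply: dis; rewrite mem_cat restE.
Qed.

Lemma test_answer directed md A n Q t l r : t < n -> l < n ->
  dist_answer directed (num_vertices n) 0 (target n)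
    (foldl (next_graph md) (initial_edges md A n) (before_test md n Q t l)) r ->
  (r < test_bound n (clock md n t) (clock md n l)) =
  triangle A n (clock md n l) (Q t).
Proof.
move=> tn ln; have memE := before_test_graph md A Q tn ln.
apply: test_graph_dist; rewrite ?clock_lt //; split.
- by move=> e ef; rewrite memE mem_cat ef.
- by rewrite memE mem_cat start_link_live orbT.
- by rewrite memE mem_cat end_link_live orbT.
- by move=> k j k2 jn qk; rewrite memE mem_cat gate_live ?orbT.
move=> e; rewrite memE mem_cat => /orP[ef|el]; [by left|right].
exact: live_links_current el.
Qed.

(** * Preprocessing *)

Definition esucc (e : expr) : expr := EAdd (ENat 1) e.

Definition esquare : expr := EMul EDim EDim.

Definition ecell (x j : expr) : expr := EAdd (EMul x EDim) j.

Definition evertex (b : nat) (o : expr) : expr :=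
  EAdd (EMul (ENat b) (EMul EDim (esucc EDim))) o.

Definition epath_edge (b : nat) (k : expr) : expr * expr :=
  (evertex b k, evertex b (esucc k)).

Definition ecolumn_edge (b : nat) (x j : expr) : expr * expr :=
  (evertex b (ecell x j), evertex b (ecell (esucc x) j)).

Definition earc (l : nat) (x j a : expr) : expr * expr :=
  (evertex l.*2.+1 x, evertex l.*2.+2 (ecell a j)).

Definition egate (l : nat) (x j : expr) : expr * expr :=
  (evertex l.*2.+2 (ecell (esucc x) j), evertex l.*2.+3 j).

Definition estart_link (x j : expr) : expr * expr :=
  (evertex 0 (ecell x j), evertex 1 j).

(* [r] is n * n - (x * n + j). *)
Definition eend_link (j r : expr) : expr * expr :=
  (evertex 6 (EAdd EDim j), evertex 7 r).

Definition cell_exprs (x j a r : expr) : seq (expr * expr) :=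
  [:: epath_edge 0 (ecell x j); estart_link x j;
      ecolumn_edge 1 x j; earc 0 x j a; ecolumn_edge 2 x j; egate 0 x j;
      ecolumn_edge 3 x j; earc 1 x j a; ecolumn_edge 4 x j; egate 1 x j;
      ecolumn_edge 5 x j; earc 2 x j a; ecolumn_edge 6 x j; eend_link j r;
      epath_edge 7 (ecell x j)].

Definition acts (ps : seq (expr * expr)) : prog :=
  foldr (fun p => Then (Act p)) Nop ps.

Lemma trace_acts n inp ps env :
  trace n inp (acts ps) env = [seq Update (eval_pair n env p) | p <- ps].
Proof. by elim: ps => //= p ps ->. Qed.

Lemma safe_acts w n inp verdict answer ps env past :
  all (word_pair w) [seq eval_pair n env p | p <- ps] ->
  safe w n inp verdict answer (acts ps) env past.
Proof.
by elim: ps past => //= p ps IH past /andP[sm /IH]; split.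
Qed.

Definition emit_edges (ks : seq nat) : prog :=
  let x := EVar 0 in let j := EVar 1 in
  Loop (Loop (Bind (Input (esucc (ecell x j)))
    (Bind (Diff esquare (ecell x j))
      (acts [seq nth (ENat 0, ENat 0) (cell_exprs x j (EVar 2) (EVar 3)) c
            | c <- ks])))).

Definition header_exprs : seq (expr * expr) :=
  [:: (EMul (ENat 8) (EMul EDim (esucc EDim)), EMul (ENat 15) esquare);
      (ENat 0, evertex 7 esquare)].

Definition prep_prog (md : mode) : prog :=
  Then (acts header_exprs) (Then (emit_edges fixed_kinds)
    (if is_dec md then emit_edges link_kinds else Nop)).

Definition graph_pairs (md : mode) A (n : nat) : seq (nat * nat) :=
  [:: (num_vertices n, num_edges n); (0, target n)] ++ initial_edges md A n.

Definition words_of (es : seq (nat * nat)) : seq nat :=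
  flatten [seq edge_words e | e <- es].

Lemma size_words_of es : size (words_of es) = 2 * size es.
Proof. by elim: es => //= e es; rewrite /words_of /= => ->; lia. Qed.

Lemma words_of_rcons es e :
  words_of (rcons es e) = rcons (rcons (words_of es) e.1) e.2.
Proof. by rewrite /words_of map_rcons flatten_rcons -!cats1 -catA. Qed.

Lemma graph_wordsE md A n :
  graph_words (num_vertices n) (num_edges n) 0 (target n)
    (initial_edges md A n) = words_of (graph_pairs md A n).
Proof. by []. Qed.

Lemma edges_of_big A n ks :
  edges_of A n ks = \big[cat/[::]]_(0 <= x < n) \big[cat/[::]]_(0 <= j < n)
    [seq edge A n c x j | c <- ks].
Proof. by rewrite /edges_of /flatten foldrE big_map big_allpairs. Qed.

(* The largest numbers handled are below 30 * (n * n) + 30. *)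
Definition wide (w n : nat) : Prop := 30 * (n * n) + 30 <= 2 ^ w.

Lemma wide_word w n : wide w n -> 0 < w.
Proof. by case: w => //; rewrite /wide expn0; lia. Qed.

Lemma wide_dim w n : wide w n -> n < 2 ^ w.
Proof. by rewrite /wide; nia. Qed.

Lemma edge_word_pair w n A e : 0 < n -> wide w n ->
  e \in fixed_edges A n ++ links A n -> word_pair w e.
Proof.
move=> n0 wd /edge_bounds /andP[e12 eN].
have e2w : e.2 < 2 ^ w.
  by move: wd eN; rewrite /wide /num_vertices /block_size mulnS; nia.
by rewrite /word_pair e2w (ltn_trans e12).
Qed.

Section Preprocessing.
Variables (w n : nat) (inp : nat -> nat) (A : nat -> nat -> bool) (md : mode).
Hypotheses (n_gt0 : 0 < n) (w_wide : wide w n).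
Hypothesis inpE : forall x j, x < n -> j < n -> inp (x * n + j).+1 = A x j.

Lemma eval_cell_expr c x j : c < 15 -> x < n -> j < n ->
  eval_pair n [:: x; j; nat_of_bool (A x j); n * n - (x * n + j)]
    (nth (ENat 0, ENat 0) (cell_exprs (EVar 0) (EVar 1) (EVar 2) (EVar 3)) c) =
  edge A n c x j.
Proof. by move=> c15 xn jn; do 15 (case: c c15 => [|c] c15; first by []). Qed.

Lemma trace_emit_edges ks : all (fun c => c < 15) ks ->
  trace n inp (emit_edges ks) [::] = [seq Update e | e <- edges_of A n ks].
Proof.
move=> /allP ks15.
have map_big := big_morph (map Update) (@map_cat _ _ _) erefl.
rewrite edges_of_big map_big; apply: eq_big_nat => x /andP[_ xn].
rewrite map_big; apply: eq_big_nat => j /andP[_ jn].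
apply: etrans (trace_acts _ _ _ _) _.
rewrite -!map_comp /= [inp _]inpE //.
by apply/eq_in_map => c /ks15 c15; congr Update; apply: eval_cell_expr.
Qed.

Lemma safe_emit_edges verdict answer ks past :
  {subset ks <= fixed_kinds ++ link_kinds} ->
  safe w n inp verdict answer (emit_edges ks) [::] past.
Proof.
move=> ks_sub; rewrite /emit_edges /= => x xn j jn; have cn := cell_lt xn jn.
have nw : (n * n).+1 < 2 ^ w by move: w_wide; rewrite /wide; lia.
split; first by rewrite /=; lia.
split; first by rewrite /=; lia.
apply: safe_acts; rewrite !all_map; apply/allP => c /ks_sub ck.
rewrite /= inpE //.
have c15 : c < 15 by move: c ck; apply/allP.
rewrite eval_cell_expr //; apply: (@edge_word_pair _ n A) => //.
rewrite mem_cat; apply/orP.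
by move: ck; rewrite mem_cat => /orP[ck|ck]; [left|right]; apply/edges_ofP;
  exists c, x, j.
Qed.

Lemma trace_prep_prog :
  trace n inp (prep_prog md) [::] = [seq Update e | e <- graph_pairs md A n].
Proof.
rewrite map_cat /initial_edges map_cat -trace_emit_edges //=.
congr [:: _, _ & _].
by case: is_dec => //; rewrite -trace_emit_edges.
Qed.

Lemma safe_prep_prog verdict answer past :
  safe w n inp verdict answer (prep_prog md) [::] past.
Proof.
have bounds : [&& 8 * (n * (1 + n)) < 2 ^ w, 15 * (n * n) < 2 ^ w, 0 < 2 ^ w
    & 7 * (n * (1 + n)) + n * n < 2 ^ w].
  by move: w_wide; rewrite /wide; nia.
split; first by apply: safe_acts; rewrite /= /word_pair /= -!andbA andbT.
split; first by apply: safe_emit_edges => c cf; rewrite mem_cat cf.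
by case: is_dec => //; apply: safe_emit_edges => c cf; rewrite mem_cat cf orbT.
Qed.

Lemma size_graph_pairs : size (graph_pairs md A n) <= 15 * (n * n) + 2.
Proof.
rewrite size_cat /= addnC leq_add2r -[15 * _](size_fixed_links A n).
by rewrite /initial_edges !size_cat leq_add2l; case: is_dec.
Qed.

End Preprocessing.

(* Register 0 of the simulated algorithm serves as the output pointer and thus
   holds the input length in the end. *)
Definition append_word (x one : nat) : cmd :=
  Seq (Write 1 reg_shift x) (Op reg_shift Add reg_shift one).

Definition emit (d : nat) : cmd :=
  Seq (Const d.+2 1) (Seq (append_word d d.+2) (append_word d.+1 d.+2)).

Definition start_state (w : nat) (ws : seq nat) : state :=
  with_input w ws state0.

Definition call_overhead := 5.

Lemma append_word_runs w ws x one st :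
  embeds (start_state w ws) st -> x < reg_shift -> one < reg_shift ->
  0 < w -> reg st one = 1 -> reg st x < 2 ^ w -> size ws + 1 < 2 ^ w ->
  exists st', [/\ runs w (append_word x one) st 2 st',
    embeds (start_state w (rcons ws (reg st x))) st'
    & same_below reg_shift st st'].
Proof.
move=> [er ea] xr oner w0 one1 xw sw.
have ptr : reg st reg_shift = size ws.
  by rewrite -[reg_shift]add0n er /= /wrap modn_small //; lia.
set st1 := set_arr 1 (reg st reg_shift) (reg st x) st.
set st2 :=
  set_reg reg_shift (eval_binop w Add (reg st1 reg_shift) (reg st1 one)) st1.
exists st2.
split; first exact: runs_seq (runs_write _ _ _ _ _) (runs_op _ _ _ _ _ _).
- split=> [y|a j].
    rewrite /= ptr one1 size_rcons -[X in _ == X]add0n eqn_add2r.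
    by case: eqP => [_|/eqP/negbTE y0]; rewrite ?er /= ?y0 // /eval_binop addn1.
  rewrite /= ptr eqSS ea /= size_rcons nth_rcons.
  case: (a == 0) => //=; case: (ltngtP j (size ws)) => [jw|jw|->].
  - by rewrite ltnW.
  - by rewrite ltnNge jw.
  - by rewrite ltnSn /wrap modn_small.
by split=> // y yr; rewrite /= ltn_eqF.
Qed.

(* While the graph is written, [Update e] stands for the output of [e]. *)
Definition building (w : nat) (past rest : seq request) (T : nat) (sg : state) :
    Prop :=
  sg = start_state w (words_of (updates past)) /\
  2 * size (past ++ rest) < 2 ^ w.

Lemma updates_rcons qs e :
  updates (rcons qs (Update e)) = rcons (updates qs) e.
Proof. by rewrite -!cats1 updates_cat. Qed.

Lemma emit_sound w : 0 < w -> act_spec w emit call_overhead (building w).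
Proof.
move=> w0 d e past rest T sg st dr /andP[e1w e2w] d1 d2 em [sgE sz].
rewrite sgE in em.
have sw : size (words_of (updates past)) + 2 < 2 ^ w.
  rewrite size_words_of; move: sz; rewrite size_cat /=.
  by have := size_updates_le past; lia.
set st1 := set_reg d.+2 (wrap w 1) st.
have em1 : embeds (start_state w (words_of (updates past))) st1.
  by apply: embeds_set_own_reg em; lia.
have [v1 v2] : reg st1 d = e.1 /\ reg st1 d.+1 = e.2.
  by rewrite /= !ltn_eqF // d1 d2.
have one1 : reg st1 d.+2 = 1 by rewrite /= eqxx /wrap modn_small ?word_gt1.
have [||||st2 [r2 em2 [own2 a2]]] := append_word_runs (x := d) em1 _ _ w0 one1.
- by lia.
- by lia.
- by rewrite v1.
- by lia.
rewrite v1 in em2.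
have [|||||st3 [r3 em3 own3]] :=
  append_word_runs (x := d.+1) (one := d.+2) em2 _ _ w0.
- by lia.
- by lia.
- by rewrite own2 //; lia.
- by rewrite own2 ?v2 //; lia.
- by rewrite size_rcons; lia.
exists 5, T, st3; split.
- exact: runs_seq (runs_const _ _ _ _) (runs_seq r2 r3).
- by rewrite addnC.
exists (start_state w (words_of (updates (rcons past (Update e))))); split.
- have same1 : same_below d st st1.
    by apply/scratch_same_below/scratch_set_reg; lia.
  have same12 := same_below_trans same1 (same_below_leq _ (conj own2 a2)).
  by apply: same_below_trans (same12 _) (same_below_leq _ own3); lia.
- by rewrite updates_rcons words_of_rcons -v2 -own2 //; lia.
- by split=> //; move: sz; rewrite !size_cat size_rcons /=; lia.
Qed.

Definition prep_cmd (md : mode) (D : sp_algorithm) : cmd :=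
  Seq (Seq (Const 2 0) (Read 2 0 2))
    (Seq (compile emit Skip 3 (prep_prog md))
       (Seq (Const 3 0) (shift_cmd (sp_prep D)))).

Definition prep_time (md : mode) : nat :=
  time call_overhead 1 (prep_prog md) + 6.

Lemma skip_sound w :
  ask_spec w (fun _ _ => True) Skip call_overhead (building w).
Proof.
move=> past rest T sg st em [sgE sz].
exists 1, T, st; split; [exact: runs_skip|by rewrite /call_overhead; lia|].
exists sg; split=> //; split; first by rewrite -cats1 updates_cat cats0.
by move: sz; rewrite !size_cat size_rcons /=; lia.
Qed.

Definition row_fun (n : nat) (x : 'rV[bool]_n) (j : nat) : bool :=
  if insub j is Some i then x ord0 i else false.

Definition mat_fun (n : nat) (A : 'M[bool]_n) (i j : nat) : bool :=
  if insub i is Some i' then row_fun (row i' A) j else false.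

Lemma row_funE n (x : 'rV[bool]_n) (j : 'I_n) : row_fun x j = x ord0 j.
Proof. by rewrite /row_fun valK. Qed.

Lemma mat_funE n (A : 'M[bool]_n) (i j : 'I_n) : mat_fun A i j = A i j.
Proof. by rewrite /mat_fun valK row_funE mxE. Qed.

Lemma nth_allpairs (S T R : Type) (f : S -> T -> R) s0 t0 r0 s t i j :
  i < size s -> j < size t ->
  nth r0 [seq f x y | x <- s, y <- t] (i * size t + j) =
  f (nth s0 s i) (nth t0 t j).
Proof.
elim: s i => //= x s IH [|i] /= il jl; rewrite nth_cat size_map.
  by rewrite mul0n jl (nth_map t0).
by rewrite ifN -?leqNgt ?mulSn -?addnA ?leq_addr // addKn IH.
Qed.

Lemma nth_matrix_words n (A : 'M[bool]_n) x j : x < n -> j < n ->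
  nth 0 (matrix_words A) (x * n + j).+1 = mat_fun A x j.
Proof.
move=> xn jn; have := nth_allpairs (fun i j => nat_of_bool (A i j))
  (Ordinal xn) (Ordinal jn) 0 (s := enum 'I_n) (t := enum 'I_n)
  (i := x) (j := j).
rewrite !size_enum_ord => /(_ xn jn) /= ->.
rewrite (nth_ord_enum _ (Ordinal xn)) (nth_ord_enum _ (Ordinal jn)).
by rewrite -mat_funE.
Qed.

Lemma size_matrix_words n (A : 'M[bool]_n) :
  size (matrix_words A) = (n * n).+1.
Proof. by rewrite /= size_allpairs !size_enum_ord. Qed.

Lemma wrap_bool w (b : bool) : 0 < w -> wrap w b = b.
Proof.
by move=> w0; rewrite /wrap modn_small //; have := word_gt1 w0; case: b; lia.
Qed.

Lemma matrix_inputE w n (A : 'M[bool]_n) st x j : 0 < w -> x < n -> j < n ->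
  arr (with_input w (matrix_words A) st) 0 (x * n + j).+1 = mat_fun A x j.
Proof.
move=> w0 xn jn; rewrite /with_input /arr size_matrix_words.
by rewrite ltnS cell_lt // nth_matrix_words // wrap_bool.
Qed.

Lemma load_dim_runs w n (A : 'M[bool]_n)
    (st := with_input w (matrix_words A) state0) :
  wide w n -> exists st', [/\ runs w (Seq (Const 2 0) (Read 2 0 2)) st 2 st',
    own_memory n (arr st 0) [::] false st' & embeds (start_state w [::]) st'].
Proof.
move=> wd; have w0 := wide_word wd.
set st1 := set_reg 2 (wrap w 0) st.
exists (set_reg 2 (arr st1 0 (reg st1 2)) st1); split.
- exact: runs_seq (runs_const _ _ _ _) (runs_read _ _ _ _ _).
- split=> //=; rewrite /wrap mod0n /= modn_small //; exact: wide_dim.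
do 2 apply: embeds_set_own_reg => //; split=> [x|a i]; rewrite /st /=.
  by rewrite addn_eq0 andbF /wrap mod0n if_same.
by rewrite ltn0 andbF.
Qed.

Lemma prep_correct w md D n (A : 'M[bool]_n) sg tp :
  0 < n -> wide w n ->
  call w (sp_prep D) (graph_words (num_vertices n) (num_edges n) 0 (target n)
    (initial_edges md (mat_fun A) n)) state0 tp sg ->
  exists t st, [/\ call w (prep_cmd md D) (matrix_words A) state0 t st,
    embeds sg st, reg st 2 = n, reg st 3 = 0 & t <= prep_time md * n ^ 2 + tp].
Proof.
move=> n0 wd [tD ->]; rewrite graph_wordsE => runD.
have w0 := wide_word wd; have nw := wide_dim wd.
have [st1 [r1 ow1 em1]] := load_dim_runs A wd.
set inp := arr _ 0 in ow1.
have inpE x j : x < n -> j < n -> inp (x * n + j).+1 = mat_fun A x j.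
  exact: matrix_inputE.
have trE := trace_prep_prog md inpE.
have := compile_sound (inp := inp) w0 nw (verdict := xpredT)
  (emit_sound w0) (@skip_sound w) (p := prep_prog md) (env := [::]) (b := false)
  (past := [::]) (rest := [::]) (T := 0) (st := st1).
case=> [|||t2 [T2 [st2 [r2 le2]]]].
- by case: (md).
- exact: (safe_prep_prog (A := mat_fun A)).
- exists (start_state w [::]); split=> //; split=> //.
  rewrite trE cats0 cat0s size_map.
  move: wd (size_graph_pairs n (mat_fun A) md).
  by rewrite /wide; lia.
rewrite trE /= => -[sg2 [[_ n2 _ _] em2 [sg2E _]]].
have em3 := embeds_set_own_reg (wrap w 0) (isT : 3 < reg_shift) em2.
have pairsE : updates [seq Update e | e <- graph_pairs md (mat_fun A) n] =
    graph_pairs md (mat_fun A) n.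
  exact: map_pK.
rewrite sg2E pairsE in em3.
have [st4 [r4 em4 own4]] := shift_runs runD em3.
exists ((size (matrix_words A)).+1 + (2 + (t2 + (1 + tD)))), st4; split=> //.
- eexists; first by [].
  exact: runs_seq r1 (runs_seq r2 (runs_seq (runs_const _ _ _ _) r4)).
- by case: own4 => ->.
- by case: own4 => -> // _; rewrite /= /wrap mod0n.
have nn : 0 < n ^ 2 by rewrite expn_gt0 n0.
have := time_polynomial call_overhead (prep_prog md) n0.
have -> : nesting (prep_prog md) = 2 by case: (md).
rewrite size_matrix_words mulnn /prep_time mulnDl.
by move: le2; lia.
Qed.

(** * Answering a query *)

Definition clock_term (md : mode) (e : expr) : term :=
  if md is Incremental then Diff EDim (esucc e) else Val e.

(* The local variables of [query_prog] are the number of earlier queries, the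
   time, the loop index, and the row under test. *)
Definition etime : expr := EVar 1.
Definition eindex : expr := EVar 2.
Definition erow : expr := EVar 3.

Definition ebound : expr :=
  EAdd (EAdd (EMul (ENat 2) (ecell etime erow)) (EMul (ENat 2) etime)) (ENat 8).

Definition gate_step (b : bool) (l : nat) : prog :=
  Bind (Input (EAdd (EMul (ENat l.+1) EDim) eindex))
    (When b 3 (Act (egate l etime eindex))).

Definition gate_prog (b : bool) : prog :=
  Loop (Then (gate_step b 0) (gate_step b 1)).

Definition link_prog : prog :=
  Bind (Diff esquare (ecell etime erow))
    (acts [:: estart_link etime erow; eend_link erow (EVar 4)]).

Definition test_prog : prog := Bind (Input erow) (When false 4 (Ask ebound)).

Definition row_prog (md : mode) : prog :=
  Bind (clock_term md eindex)
    (if is_dec md then Then test_prog link_prog else Then link_prog test_prog).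

Definition query_prog (md : mode) : prog :=
  Bind (clock_term md (EVar 0))
    (Then (gate_prog (is_dec md))
       (Then (Loop (row_prog md)) (gate_prog (~~ is_dec md)))).

Lemma bit_neq0 (b : bool) : (nat_of_bool b != 0) = b.
Proof. by case: b. Qed.

Section Query.
Variables (md : mode) (w n : nat) (inp : nat -> nat) (q : nat -> nat -> bool).
Variables (A : nat -> nat -> bool) (answer : seq request -> nat -> Prop).
Hypothesis w_wide : wide w n.
Hypothesis inpE : forall l j, l < 3 -> j < n -> inp (l * n + j) = q l j.

Let verdict (env : seq nat) : bool := triangle A n (nth 0 env 3) q.

Lemma clock_termE env e :
  term_value n inp env (clock_term md e) = clock md n (eval n env e).
Proof. by case: md. Qed.

Lemma clock_term_safe env e :
  eval n env e < n -> term_safe w n env (clock_term md e).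
Proof.
have nw := wide_dim w_wide; case: md => /= en; last exact: ltn_trans nw.
by rewrite en.
Qed.

Lemma trace_gate_prog b t h :
  trace n inp (gate_prog b) [:: t; h] = gate_phase n h q b.
Proof.
apply: eq_big_nat => j /andP[_ jn]; rewrite /= [inp _]inpE // inpE //.
by rewrite !bit_neq0 /gate_requests.
Qed.

Lemma found_gate_prog b t h :
  found n inp verdict (gate_prog b) [:: t; h] = false.
Proof. by apply/hasP => -[j _]; rewrite /= !andbF. Qed.

Lemma link_word_pair c h j :
  c \in link_kinds -> h < n -> j < n -> word_pair w (edge A n c h j).
Proof.
move=> cl hn jn; apply: (@edge_word_pair _ n A) => //; first by lia.
by rewrite mem_cat; apply/orP; right; apply/edges_ofP; exists c, h, j.
Qed.

Lemma safe_gate_prog b t h past : h < n ->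
  safe w n inp verdict answer (gate_prog b) [:: t; h] past.
Proof.
move=> hn j jn; split; split;
  rewrite /= ?(@link_word_pair 5) ?(@link_word_pair 9) //;
  by move: w_wide; rewrite /wide; nia.
Qed.

Lemma trace_test_prog t h l i : i < n ->
  trace n inp test_prog [:: t; h; l; i] = test_requests q i.
Proof. by move=> iN; rewrite /= (@inpE 0) // bit_neq0 addbF. Qed.

Lemma trace_row_prog t h l : l < n ->
  trace n inp (row_prog md) [:: t; h; l] = row_requests md n h q l.
Proof.
move=> ln; rewrite /row_prog [LHS]/= clock_termE /row_requests.
have := trace_test_prog t h l (clock_lt md ln).
by case: is_dec => /= ->.
Qed.

Lemma found_row_prog t h l : l < n ->
  found n inp verdict (row_prog md) [:: t; h; l] =
  q 0 (clock md n l) && triangle A n (clock md n l) q.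
Proof.
move=> ln; rewrite /row_prog [LHS]/= clock_termE /=.
have iN := clock_lt md ln.
by case: is_dec => /=; rewrite (@inpE 0) // bit_neq0 addbF ?orbF.
Qed.

Lemma trace_query_prog t : t < n ->
  trace n inp (query_prog md) [:: t] = query_requests md n (clock md n t) q.
Proof.
move=> tn; rewrite -[t in RHS]/(eval n [:: t] (EVar 0)) -clock_termE.
rewrite /query_requests -!(trace_gate_prog _ t); congr (_ ++ (_ ++ _)).
by apply: eq_big_nat => l /andP[_ ln]; apply: trace_row_prog.
Qed.

Lemma found_query_prog t :
  found n inp verdict (query_prog md) [:: t] =
  has (fun l => q 0 (clock md n l) && triangle A n (clock md n l) q)
    (index_iota 0 n).
Proof.
set h := term_value n inp [:: t] (clock_term md (EVar 0)).
rewrite -[LHS]/(found n inp verdict (gate_prog (is_dec md)) [:: t; h] ||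
  (has (fun l => found n inp verdict (row_prog md) [:: t; h; l])
    (index_iota 0 n) ||
   found n inp verdict (gate_prog (~~ is_dec md)) [:: t; h])).
rewrite !found_gate_prog orbF.
by apply: eq_in_has => l; rewrite mem_index_iota => /found_row_prog->.
Qed.

Lemma safe_link_prog t h l i past : h < n -> i < n ->
  safe w n inp verdict answer link_prog [:: t; h; l; i] past.
Proof.
move=> hn iN; have cn := cell_lt hn iN.
split; first by move: w_wide; rewrite /wide /=; lia.
by apply: safe_acts; rewrite /= (@link_word_pair 1) ?(@link_word_pair 13).
Qed.

Lemma safe_test_prog t h l i past : h < n -> i < n ->
  (forall r, answer past r -> (r < test_bound n h i) = triangle A n i q) ->
  safe w n inp verdict answer test_prog [:: t; h; l; i] past.
Proof.
move=> hn iN ans; have cn := cell_lt hn iN.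
split; first by move: w_wide; rewrite /wide /=; nia.
by move=> _; split; first by move: w_wide; rewrite /wide /=; nia.
Qed.

Lemma safe_row_prog t h l past : h < n -> l < n ->
  (forall r, answer
     (past ++ if is_dec md then [::] else link_requests n h (clock md n l)) r ->
     (r < test_bound n h (clock md n l)) = triangle A n (clock md n l) q) ->
  safe w n inp verdict answer (row_prog md) [:: t; h; l] past.
Proof.
move=> hn ln ans; split; first exact: clock_term_safe.
rewrite clock_termE; have iN := clock_lt md ln; move: ans.
case: is_dec => ans; split.
- by apply: safe_test_prog; rewrite // -[past]cats0.
- exact: safe_link_prog.
- exact: safe_link_prog.
- exact: safe_test_prog.
Qed.

Lemma safe_query_prog t past (h := clock md n t) : t < n ->
  (forall l r, l < n -> answer (past ++ gate_phase n h q (is_dec md) ++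
     \big[cat/[::]]_(0 <= k < l) row_requests md n h q k ++
     (if is_dec md then [::] else link_requests n h (clock md n l))) r ->
     (r < test_bound n h (clock md n l)) = triangle A n (clock md n l) q) ->
  safe w n inp verdict answer (query_prog md) [:: t] past.
Proof.
move=> tn ans; have hn : h < n by exact: clock_lt.
split; first exact: clock_term_safe.
rewrite clock_termE; split; first exact: safe_gate_prog.
split; last exact: safe_gate_prog.
move=> l ln; apply: safe_row_prog => // r.
rewrite [trace _ _ _ _]trace_gate_prog.
have -> : \big[cat/[::]]_(0 <= k < l)
    trace n inp (row_prog md) (rcons [:: t; h] k) =
    \big[cat/[::]]_(0 <= k < l) row_requests md n h q k.
  by apply: eq_big_nat => k /andP[_ kl]; apply/trace_row_prog/(ltn_trans kl).
by rewrite -!catA; apply: ans.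
Qed.

End Query.

(** * The reduction *)

Definition store_word (d k x : nat) : cmd := Seq (Const d k) (Write 1 d x).

Lemma store_word_runs w d k x sg st :
  k < 2 ^ w -> x < d < reg_shift -> embeds sg st ->
  exists st', [/\ runs w (store_word d k x) st 2 st',
    embeds (set_arr 0 k (reg st x) sg) st' & same_below d st st'].
Proof.
move=> kw /andP[xd dr] em; set st1 := set_reg d (wrap w k) st.
have kE : reg st1 d = k by rewrite /= eqxx /wrap modn_small.
have xE : reg st1 x = reg st x by rewrite /= ltn_eqF.
exists (set_arr 1 (reg st1 d) (reg st1 x) st1); split.
- exact: runs_seq (runs_const _ _ _ _) (runs_write _ _ _ _ _).
- by rewrite kE xE; apply/embeds_set_arr/embeds_set_own_reg.
by split=> // y yd; rewrite /= ltn_eqF.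
Qed.

Lemma embeds_with_input w ws sg sg' st : size ws < 2 ^ w ->
  (forall x, reg sg' x = reg sg x) ->
  (forall a j, arr sg' a j =
     if (a == 0) && (j < size ws) then wrap w (nth 0 ws j) else arr sg a j) ->
  embeds sg' st ->
  embeds (with_input w ws sg) (set_reg reg_shift (size ws) st).
Proof.
move=> sw rE aE [er ea]; split=> [x|a j]; last by rewrite /= ea aE.
by rewrite /= -[X in _ == X]add0n eqn_add2r er rE /wrap modn_small.
Qed.

Section Serving.
Variables (directed : bool) (md : mode) (D : sp_algorithm) (w N s t : nat).
Variable E0 : seq (nat * nat).
Hypothesis w_gt1 : 1 < w.

Let current_graph (past : seq request) := foldl (next_graph md) E0 past.

Definition serving (past rest : seq request) (T : nat) (sg : state) : Prop :=
  serves w (sp_proc D) request_words (next_graph md) (request_ok directed N s t)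
    (current_graph past) rest sg T.

Lemma serving_cons past r rest T sg : serving past (r :: rest) T sg ->
  exists T1 T2 sg', [/\
    runs w (sp_proc D r) (with_input w (request_words r) sg) T1 sg',
    request_ok directed N s t (current_graph past) r (output sg'),
    serving (rcons past r) rest T2 sg'
    & T = (size (request_words r)).+1 + T1 + T2].
Proof.
move=> sv; inversion sv as [|E1 r1 rs sg1 t1 sg' T' [t' t1E run] ok sv']; subst.
by exists t', T', sg'; rewrite /serving /current_graph foldl_rcons.
Qed.

Let two_fits : 2 < 2 ^ w.
Proof. by rewrite -[X in X < _](expn1 2) ltn_exp2l. Qed.

Definition send (d : nat) : cmd :=
  Seq (Seq (store_word d.+2 0 d) (store_word d.+2 1 d.+1))
    (Seq (Const reg_shift 2) (shift_cmd (sp_update D))).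

Lemma send_sound : act_spec w send call_overhead serving.
Proof.
move=> d e past rest T sg st dr /andP[e1w e2w] d1 d2 em.
case/serving_cons=> T1 [T2 [sg1 [run _ sv ->]]].
have [||st1 [r1 em1 own1]] := @store_word_runs w d.+2 0 d sg st _ _ em; try lia.
have [||st2 [r2 em2 own2]] :=
  @store_word_runs w d.+2 1 d.+1 _ _ _ _ em1; try lia.
rewrite (own1.1 d.+1) // d1 d2 in em2.
have em3 : embeds (with_input w (edge_words e) sg)
    (set_reg reg_shift (wrap w 2) st2).
  rewrite [wrap w 2]modn_small //; apply: embeds_with_input em2 => // a j.
  rewrite /=; case: (a == 0) => //=.
  by case: j => [|[|j]] //=; rewrite /wrap modn_small.
have [st4 [r4 em4 own4]] := shift_runs run em3.
exists (2 + 2 + (1 + T1)), T2, st4; split.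
- exact: runs_seq (runs_seq r1 r2) (runs_seq (runs_const _ _ _ _) r4).
- by rewrite /= /call_overhead; lia.
exists sg1; split=> //.
have own12 := same_below_trans own1 own2.
have own3 : same_below reg_shift st2 (set_reg reg_shift (wrap w 2) st2).
  by split=> // y yr; rewrite /= ltn_eqF.
apply: same_below_trans (same_below_leq _ own12) _; first by lia.
by apply: same_below_leq (same_below_trans own3 own4); lia.
Qed.

Definition ask : cmd := Seq (Const reg_shift 0) (shift_cmd (sp_query D)).

Lemma ask_sound : ask_spec w
  (fun past => dist_answer directed N s t (current_graph past))
  ask call_overhead serving.
Proof.
move=> past rest T sg st em /serving_cons[T1 [T2 [sg1 [run ok sv ->]]]].
have em1 : embeds (with_input w [::] sg) (set_reg reg_shift (wrap w 0) st).
  rewrite [wrap w 0]mod0n; apply: (embeds_with_input (ws := [::])) em => //.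
    by rewrite /= expn_gt0.
  by move=> a j; rewrite ltn0 andbF.
have [st2 [r2 em2 own2]] := shift_runs run em1.
exists (1 + T1), T2, st2; split.
- exact: runs_seq (runs_const _ _ _ _) r2.
- by rewrite /= /call_overhead; lia.
exists sg1; split=> //; apply: same_below_trans own2.
by split=> // y yr; rewrite /= ltn_eqF.
Qed.

End Serving.

Definition query_cmd (md : mode) (D : sp_algorithm) : cmd :=
  Seq (Const 1 0)
    (Seq (compile (send D) (ask D) 4 (query_prog md))
       (Seq (Const 4 1) (Op 3 Add 3 4))).

Definition query_bits (n : nat) (q : omv3_query n) (l : nat) : nat -> bool :=
  row_fun (match l with 0 => q.1.1 | 1 => q.1.2 | _ => q.2 end).

Lemma size_vector_words n (x : 'rV[bool]_n) : size (vector_words x) = n.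
Proof. by rewrite size_map size_enum_ord. Qed.

Lemma nth_vector_words n (x : 'rV[bool]_n) j : j < n ->
  nth 0 (vector_words x) j = row_fun x j.
Proof.
move=> jn; rewrite (nth_map (Ordinal jn)) ?size_enum_ord //.
by rewrite (nth_ord_enum _ (Ordinal jn)) -row_funE.
Qed.

Lemma size_omv3_words n (q : omv3_query n) : size (omv3_words q) = 3 * n.
Proof.
by case: q => [[u v] z]; rewrite /= !size_cat !size_vector_words; lia.
Qed.

Lemma nth_omv3_words n (q : omv3_query n) l j : l < 3 -> j < n ->
  nth 0 (omv3_words q) (l * n + j) = query_bits q l j.
Proof.
move=> l3 jn; case: q => [[u v] z].
have skip s1 s2 i : size s1 = n -> nth 0 (s1 ++ s2) (n + i) = nth 0 s2 i.
  by move=> sz; rewrite nth_cat sz ltnNge leq_addr addKn.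
case: l l3 => [|[|[|//]]] _; rewrite /query_bits /=.
- by rewrite nth_cat size_vector_words jn nth_vector_words.
- rewrite mul1n skip ?size_vector_words // nth_cat size_vector_words jn.
  by rewrite nth_vector_words.
by rewrite mulSn mul1n -addnA !skip ?size_vector_words // nth_vector_words.
Qed.

Lemma omv3_inputE w n (q : omv3_query n) st l j : 0 < w -> l < 3 -> j < n ->
  arr (with_input w (omv3_words q) st) 0 (l * n + j) = query_bits q l j.
Proof.
move=> w0 l3 jn; rewrite /= size_omv3_words ifT; last by nia.
by rewrite nth_omv3_words // wrap_bool.
Qed.

Definition bits_at (n : nat) (qs : seq (omv3_query n)) (t : nat) :
    nat -> nat -> bool :=
  nth (fun _ _ => false) [seq query_bits q | q <- qs] t.

Lemma omv3_answerE md n (A : 'M[bool]_n) (q : omv3_query n) :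
  omv3_answer A q = has (fun l => query_bits q 0 (clock md n l) &&
    triangle (mat_fun A) n (clock md n l) (query_bits q)) (index_iota 0 n).
Proof.
case: q => [[u v] z].
apply/existsP/hasP => [[i /existsP[j /existsP[k]]]|[l]].
  case/and5P=> ui vj zk Aij /andP[Ajk Aki].
  exists (clock md n i); first by rewrite mem_index_iota clock_lt.
  rewrite clockK // /query_bits row_funE ui; apply/triangleP => //.
  by exists j, k; rewrite !row_funE !mat_funE vj zk Aij Ajk Aki.
rewrite mem_index_iota /= => /(clock_lt md); move: (clock md n l) => i iN.
case/andP=> + /(triangleP _ _ iN)[j [k [jn kn]]].
rewrite /query_bits -[i]/(val (Ordinal iN)) -[j]/(val (Ordinal jn)).
rewrite -[k]/(val (Ordinal kn)) !row_funE !mat_funE.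
move=> ui /and5P[vj zk Aij Ajk Aki].
exists (Ordinal iN); apply/existsP; exists (Ordinal jn); apply/existsP.
by exists (Ordinal kn); apply/and5P; split=> //; apply/andP.
Qed.

Definition query_time (md : mode) : nat :=
  time call_overhead 1 (query_prog md) + 7.

Section Reduction.
Variables (directed : bool) (md : mode) (D : sp_algorithm) (w n : nat).
Variables (A : 'M[bool]_n) (qs : seq (omv3_query n)).
Hypotheses (n_gt0 : 0 < n) (w_wide : wide w n) (size_qs : size qs = n).

Let Q := bits_at qs.
Let E0 := initial_edges md (mat_fun A) n.
Let serving_graph :=
  serving directed md D w (num_vertices n) 0 (target n) E0.

Definition between_queries (t T : nat) (st : state) : Prop :=
  exists sg, [/\ reg st 2 = n, reg st 3 = t, embeds sg st
    & serving_graph (schedule md n Q 0 t) (schedule md n Q t n) T sg].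

Let w_gt0 : 0 < w := wide_word w_wide.
Let n_fits : n < 2 ^ w := wide_dim w_wide.

Let w_gt1 : 1 < w.
Proof.
by move: w_wide; rewrite /wide; case: (w) w_gt0 => [|[|//]] //; lia.
Qed.

Section Query.
Variables (q : omv3_query n) (t : nat).
Hypotheses (tn : t < n) (QE : Q t = query_bits q).

Lemma trace_query (inp : nat -> nat) :
  (forall l j, l < 3 -> j < n -> inp (l * n + j) = query_bits q l j) ->
  trace n inp (query_prog md) [:: t] ++ schedule md n Q t.+1 n =
  schedule md n Q t n.
Proof.
by move=> inpE; rewrite (trace_query_prog _ inpE) // -QE [RHS]big_ltn.
Qed.

Lemma load_query T st (st0 := with_input w (omv3_words q) st) :
  between_queries t T st ->
  prog_inv n (arr st0 0) serving_graph [:: t] false (schedule md n Q 0 t)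
    (schedule md n Q t n) T (set_reg 1 (wrap w 0) st0).
Proof.
move=> [sg [r2 r3 em sv]]; exists sg; split=> //.
- by split=> //= [|[|//] _]; rewrite ?r3 // /wrap mod0n.
- apply: embeds_set_own_reg => //; case: em => er ea; split=> // x.
  by rewrite -er /= addn_eq0 andbF.
Qed.

Lemma query_prog_correct (inp : nat -> nat) T st :
  (forall l j, l < 3 -> j < n -> inp (l * n + j) = query_bits q l j) ->
  prog_inv n inp serving_graph [:: t] false (schedule md n Q 0 t)
    (schedule md n Q t n) T st ->
  amortized w (compile (send D) (ask D) 4 (query_prog md)) st T
    (time call_overhead n (query_prog md))
    (prog_inv n inp serving_graph [:: t] (omv3_answer A q)
       (schedule md n Q 0 t.+1) (schedule md n Q t.+1 n)).
Proof.
move=> inpE; rewrite -(trace_query inpE) => st_inv.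
pose verdict env := triangle (mat_fun A) n (nth 0 env 3) (query_bits q).
have := compile_sound w_gt0 n_fits (verdict := verdict)
  (send_sound w_gt1) (ask_sound w_gt1) _ _ st_inv.
rewrite (trace_query_prog _ inpE) // found_query_prog // -omv3_answerE.
rewrite -QE [schedule md n Q 0 t.+1]big_nat_recr //=.
apply; first by case: (md).
by apply: safe_query_prog => // l r ln; rewrite -QE; apply: test_answer.
Qed.

Lemma query_correct T st : between_queries t T st ->
  exists T1 T2 st', [/\ call w (query_cmd md D) (omv3_words q) st T1 st',
    output st' = omv3_answer A q, T1 + T2 <= T + query_time md * n
    & between_queries t.+1 T2 st'].
Proof.
move=> /load_query st_inv; have inpE l j := @omv3_inputE w n q st l j w_gt0.
have [t2 [T2 [st2 [r2 le2]]]] := query_prog_correct inpE st_inv.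
case=> sg [[out n2 tE _] em sv].
set st3 := set_reg 4 (wrap w 1) st2.
set st4 := set_reg 3 (eval_binop w Add (reg st3 3) (reg st3 4)) st3.
have t3 : reg st3 3 = t by rewrite /= -[RHS](tE 0).
exists ((size (omv3_words q)).+1 + (1 + (t2 + (1 + 1)))), T2, st4; split.
- eexists; first by [].
  apply: runs_seq (runs_const _ _ _ _) (runs_seq r2 _).
  exact: runs_seq (runs_const _ _ _ _) (runs_op _ _ _ _ _ _).
- by rewrite /output /= out.
- have := time_polynomial call_overhead (query_prog md) n_gt0.
  have -> : nesting (query_prog md) = 1 by case: (md).
  by rewrite size_omv3_words expn1 /query_time mulnDl; lia.
exists sg; split=> //; last by do 2 apply: embeds_set_own_reg => //.
rewrite /st4 t3 /= /eval_binop /wrap (modn_small (word_gt1 w_gt0)) addn1.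
by rewrite modn_small //; apply: leq_ltn_trans n_fits.
Qed.

End Query.

Lemma serves_queries qs1 qs2 T st : qs = qs1 ++ qs2 ->
  between_queries (size qs1) T st ->
  exists2 T', serves w (fun=> query_cmd md D) (@omv3_words n) (fun M _ => M)
      (fun M q r => r = omv3_answer M q) A qs2 st T'
    & T' <= T + size qs2 * (query_time md * n).
Proof.
elim: qs2 qs1 T st => [|q qs2 IH] qs1 T st qsE st_ok.
  by exists 0; first exact: serves_nil.
have tn : size qs1 < n by have := size_qs; rewrite qsE size_cat /=; lia.
have QE : Q (size qs1) = query_bits q.
  by rewrite /Q /bits_at qsE map_cat nth_cat size_map ltnn subnn.
have [T1 [T2 [st1 [run out le1 st1_ok]]]] := query_correct tn QE st_ok.
have [||T3 sv le3] := IH (rcons qs1 q) T2 st1.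
- by rewrite cat_rcons.
- by rewrite size_rcons.
exists (T1 + T3); first by apply: (serves_cons (st' := st1)) sv.
by rewrite /= mulSn; lia.
Qed.

End Reduction.

Lemma serves_gt0 (A Q : Type) w proc enc next ok (a : A) (q : Q) qs st T :
  serves w proc enc next ok a (q :: qs) st T -> 0 < T.
Proof. by move=> sv; inversion sv as [|? ? ? ? ? ? ? [t' -> _]]; subst. Qed.

Lemma wide_pow w n k : 0 < n -> (n + 2) ^ (4 * k.+1) <= 2 ^ w ->
  wide w n /\ (num_edges n + 2) ^ k <= 2 ^ w.
Proof.
move=> n0 hw; have base : 30 * (n * n) + 30 <= (n + 2) ^ 4.
  have -> : (n + 2) ^ 4 = ((n + 2) * (n + 2)) * ((n + 2) * (n + 2)).
    by rewrite !mulnn -expnM.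
  by case: n n0 {hw} => // m _; nia.
split.
  apply: leq_trans base (leq_trans _ hw).
  by rewrite leq_exp2l ?leq_pmulr ?addn2.
apply: leq_trans hw; rewrite expnM.
apply: (@leq_trans (((n + 2) ^ 4) ^ k)); last first.
  by rewrite leq_pexp2l // expn_gt0 addn2.
case: k => [|k]; rewrite ?expn0 // leq_exp2r //.
by apply: leq_trans base; rewrite /num_edges; lia.
Qed.

Lemma update_time_gt0 md n Q (A : Type) w proc enc next ok (a : A) sg T c u :
  0 < n -> serves w proc enc next ok a (schedule md n Q 0 n) sg T ->
  T <= c * ((num_edges n + size (schedule md n Q 0 n)) * u) -> 0 < u.
Proof.
move=> n0; have := perm_size (perm_updates_schedule md n Q (fun _ _ => false)).
have := size_updates_le (schedule md n Q 0 n); rewrite size_edges_of.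
case: schedule => [|r qs] le eq.
  by move: le; rewrite eq leqNgt !muln_gt0 n0.
by move=> sv; have := serves_gt0 sv; case: u => // T0; rewrite !muln0; lia.
Qed.

Lemma call_size w c ws st t st' : call w c ws st t st' -> size ws < t.
Proof. by case=> t' ->; rewrite leq_addr. Qed.

Lemma size_graph_words_ge md A n :
  n ^ 2 <= size (graph_words (num_vertices n) (num_edges n) 0 (target n)
    (initial_edges md A n)).
Proof.
rewrite graph_wordsE size_words_of /graph_pairs /initial_edges !size_cat.
by rewrite size_edges_of -mulnn /=; lia.
Qed.

Lemma prep_bound K c P n tp :
  n ^ 2 <= tp -> tp <= c * P -> K * n ^ 2 + tp <= K.+1 * c * P.
Proof.
move=> ntp tpP; rewrite -mulnA mulSn addnC leq_add // leq_mul2l.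
by rewrite (leq_trans ntp) ?orbT.
Qed.

Lemma query_bound K c u n r T :
  0 < u -> r <= n * (n * 5) -> T <= c * ((num_edges n + r) * u) ->
  T + n * (K * n) <= (20 * c + K) * (n ^ 2 * u).
Proof.
move=> u0 rn TP; rewrite mulnDl leq_add //; last first.
  by rewrite mulnCA mulnn leq_mul2l leq_pmulr ?orbT.
apply: leq_trans TP _; rewrite [20 * c]mulnC -mulnA leq_mul2l mulnA leq_mul2r.
by rewrite -mulnn /num_edges; apply/orP; right; apply/orP; right; lia.
Qed.

Theorem theorem8 (directed : bool) (md : mode) (P u : nat -> nat)
    (hSP : maintains_stSP directed md P u) :
  exists f : nat -> nat,
    (exists C : nat, forall n : nat, f n <= C * n ^ 2) /\
    solves_OMv3 (fun n => P (f n)) (fun n => n ^ 2 * u (f n)).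
Proof.
exists num_edges; split; first by exists 15 => n; rewrite -mulnn.
have [D [k [c spec]]] := hSP.
exists (prep_cmd md D), (query_cmd md D), (4 * k.+1).
exists ((prep_time md).+1 * c + (20 * c + query_time md)).
move=> w n A qs n0 hw size_qs; have [wd hwD] := wide_pow n0 hw.
have inst := schedule_instance directed md (mat_fun A) (bits_at qs) n0.
have [tp [T [sg [sp_call tpP sv TP]]]] := spec w _ _ _ _ _ _ hwD inst.
have [t [st [run em r2 r3 t_le]]] := prep_correct n0 wd sp_call.
have st_ok : between_queries directed md D w A qs 0 T st.
  by exists sg; rewrite /schedule big_geq.
have [T' sv' T'_le] := serves_queries (qs1 := [::]) n0 wd size_qs erefl st_ok.
exists t, T', st; split=> //.
  rewrite mulnDl (leq_trans t_le) // (leq_trans _ (leq_addr _ _)) //.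
  apply: prep_bound tpP.
  exact: leq_trans (size_graph_words_ge _ _ _) (ltnW (call_size sp_call)).
rewrite mulnDl (leq_trans T'_le) // (leq_trans _ (leq_addl _ _)) // size_qs.
apply: (query_bound _ _ (size_schedule md n _) TP).
exact: update_time_gt0 n0 sv TP.
Qed.
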